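(* Run batch Q-learning (defined in the context) with behavior policy $\pi_b$. Assume (i) $\tilde\pi_b:=\min_{(s,a)}\pi_b(a|s)>0$; (ii) the state transition matrix $P^{\pi_b}_{\mathcal S}$ is ergodic over $\mathcal S$. Let $\alpha_k=\alpha\in(0,1]$ and $c_t^k=1/B_k$ for all $k$. Then $$\mathbb E\big[\|Q^*-Q^K\|_\infty\big]\le\frac{1}{1-\gamma}[1-(1-\gamma)\alpha\tilde\sigma_b]^{K}+\alpha\left(\frac{4|\mathcal S||\mathcal A|}{(1-\gamma)^2}\Big(1+\frac{m_b}{1-\kappa_b}\Big)\right)^{1/2}\Xi(K),$$ where $\Xi(t):=\sum_{k=0}^{t-1}[1-(1-\gamma)\alpha\tilde\sigma_b]^{t-1-k}(B_k)^{-1/2}$.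
   Context: MDP: $\mathcal S,\mathcal A$ are finite nonempty sets, $P(\cdot|s,a)\in\Delta(\mathcal S)$ is the transition kernel, $r:\mathcal S\times\mathcal A\to[0,1]$ the reward, $\gamma\in[0,1)$ the discount factor; $\Delta(X)$ is the set of probability distributions on $X$. A policy is $\pi:\mathcal S\to\Delta(\mathcal A)$. $Q^\pi(s,a)=\mathbb E[\sum_{t\ge0}\gamma^t r(s_t,a_t)\mid s_0=s,a_0=a,\pi]$ and $Q^*(s,a)=\max_{\pi}Q^\pi(s,a)$. Batch Q-learning. Inputs: $K$, a behavior policy $\pi_b$, $Q^0=0\in\mathbb R^{|\mathcal S||\mathcal A|}$, critic step sizes $\alpha_k$, initial state $s_0$, deterministic batch sizes $B_k$ (positive integers), weights $c_t^k\ge0$ with $\sum_{t=0}^{B_k-1}c_t^k=1$. Set $s_0^0=s_0$. For $k=0,1,\dots,K-1$: starting from $s_0^k$ sample, for $t=0,\dots,B_k-1$, $a_t^k\sim\pi_b(\cdot|s_t^k)$, $r_t^k=r(s_t^k,a_t^k)$, $s_{t+1}^k\sim P(\cdot|s_t^k,a_t^k)$, and set $s_0^{k+1}=s_{B_k}^k$; then with $\delta_t^k(s,a)=\mathbf 1_{(s_t^k,a_t^k)=(s,a)}\big[r_t^k+\gamma\max_{a'\in\mathcal A}Q^k(s_{t+1}^k,a')-Q^k(s_t^k,a_t^k)\big]$ and $\bar\delta_k=\sum_{t=0}^{B_k-1}c_t^k\delta_t^k$, set $Q^{k+1}=Q^k+\alpha_k\bar\delta_k$. Output $Q^K$. Behavior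 chain: $P^{\pi_b}_{\mathcal S}(s,s')=\sum_a\pi_b(a|s)P(s'|s,a)$. When it is ergodic (irreducible and aperiodic) it has a unique stationary distribution $\nu^{\pi_b}$, all of whose entries are positive, and there are constants $m_b>0$, $\kappa_b\in(0,1)$ such that the induced Markov chain $\{s_t\}$ satisfies $d_{TV}(\nu^{\pi_b},\mathbb P(s_{n+t}=\cdot\mid s_n=s))\le m_b\kappa_b^t$ for all $s$, $n,t\ge0$ ($d_{TV}$ = total variation distance); $m_b,\kappa_b$ denote such constants. $\sigma^{\pi_b}(s,a)=\nu^{\pi_b}(s)\pi_b(a|s)$ and $\tilde\sigma_b=\min_{s,a}\sigma^{\pi_b}(s,a)>0$. *)

(* Defs.v *)
From HB Require Import structures.
From mathcomp Require Import all_boot all_order all_algebra.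
From mathcomp Require Import all_classical all_reals all_analysis.

Set Implicit Arguments.
Unset Strict Implicit.
Unset Printing Implicit Defensive.

Import Order.TTheory GRing.Theory Num.Theory.
Import numFieldNormedType.Exports.

Local Open Scope classical_set_scope.
Local Open Scope ring_scope.

Record dist (R : realType) (T : finType) := Dist {
  dist_fun :> T -> R;
  dist_ge0 : forall x, 0 <= dist_fun x;
  dist_sum1 : \sum_x dist_fun x = 1 }.

(* Maximum and minimum of a function on a finite nonempty type; both are
   attained there, see fmaxP and fminP. *)
Definition fmax (R : realType) (T : finType) (f : T -> R) : R := sup (range f).

Definition fmin (R : realType) (T : finType) (f : T -> R) : R := inf (range f).

Lemma fmaxP (R : realType) (T : finType) (f : T -> R) (x0 : T) :
  (exists x, fmax f = f x) /\ (forall x, f x <= fmax f).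
Proof.
have [x _ xmax] := @arg_maxP _ R T x0 xpredT f isT.
have ub : ubound (range f) (f x) by move=> _ [y _ <-]; exact: xmax.
have fle y : f y <= fmax f.
  by apply: ub_le_sup; [exists (f x) | exists y].
split=> //; exists x; apply/eqP; rewrite eq_le fle andbT.
by apply: ge_sup => //; exists (f x0), x0.
Qed.

Lemma fminP (R : realType) (T : finType) (f : T -> R) (x0 : T) :
  (exists x, fmin f = f x) /\ (forall x, fmin f <= f x).
Proof.
have [x _ xmin] := @arg_minP _ R T x0 xpredT f isT.
have lb : lbound (range f) (f x) by move=> _ [y _ <-]; exact: xmin.
have fle y : fmin f <= f y.
  by apply: ge_inf; [exists (f x) | exists y].
split=> //; exists x; apply/eqP; rewrite eq_le fle /=.
by apply: lb_le_inf => //; exists (f x0), x0.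
Qed.

Definition supnorm (R : realType) (S A : finType) (Q : S -> A -> R) : R :=
  fmax (fun x : S * A => `|Q x.1 x.2|).

Lemma dirac_dist_ge0 (R : realType) (T : finType) (x y : T) :
  0 <= (y == x)%:R :> R.
Proof. exact: ler0n. Qed.

Lemma dirac_dist_sum1 (R : realType) (T : finType) (x : T) :
  \sum_y (y == x)%:R = 1 :> R.
Proof. by rewrite (bigD1 x) //= eqxx big1 ?addr0 // => y yx; rewrite (negbTE yx). Qed.

Definition dirac_dist (R : realType) (T : finType) (x : T) : dist R T :=
  Dist (dirac_dist_ge0 R x) (dirac_dist_sum1 R x).

(* The law of (s, a) when s = s0 and a is drawn from pi. *)
Definition start_fun (R : realType) (S A : finType) (pi : S -> dist R A)
  (s0 : S) (x : S * A) : R := (x.1 == s0)%:R * pi x.1 x.2.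

Lemma start_fun_ge0 (R : realType) (S A : finType) (pi : S -> dist R A)
  (s0 : S) (x : S * A) : 0 <= start_fun pi s0 x.
Proof. by rewrite mulr_ge0 ?ler0n ?dist_ge0. Qed.

Lemma start_fun_sum1 (R : realType) (S A : finType) (pi : S -> dist R A)
  (s0 : S) : \sum_x start_fun pi s0 x = 1.
Proof.
transitivity (\sum_s \sum_a start_fun pi s0 (s, a)).
  by rewrite pair_bigA; apply: eq_bigr => -[].
rewrite (bigD1 s0) //= [X in _ + X]big1 ?addr0 => [|s ns]; last first.
  by rewrite big1 // => a _; rewrite /start_fun /= (negbTE ns) mul0r.
rewrite -[RHS](dist_sum1 (pi s0)).
by apply: eq_bigr => a _; rewrite /start_fun /= eqxx mul1r.
Qed.

Definition start_dist (R : realType) (S A : finType) (pi : S -> dist R A)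
    (s0 : S) : dist R (S * A)%type :=
  Dist (start_fun_ge0 pi s0) (start_fun_sum1 pi s0).

(* The process X = (s_t, a_t)_t on (Omega, Pr) follows the policy pi in the MDP
   with kernel P, the first pair being drawn from init. *)
Definition is_trajectory (R : realType) (S A : finType)
    (P : S -> A -> dist R S) (pi : S -> dist R A) (init : dist R (S * A)%type)
    (d : measure_display) (Omega : measurableType d) (Pr : probability Omega R)
    (X : nat -> Omega -> S * A) : Prop :=
  (forall t x, measurable [set w | X t w = x]) /\
  (forall n (x : nat -> S * A),
    Pr [set w | forall t, (t <= n)%N -> X t w = x t] =
    (init (x 0%N) * \prod_(t < n)
       (P (x t).1 (x t).2 (x t.+1).1 * pi (x t.+1).1 (x t.+1).2))%:E).

(* A Markov chain with initial law f and transition kernel g on a finite type,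
   simulated from a single uniform variable u: [0, 1[ is cut into consecutive
   cells of lengths f x, each cell is cut again in proportion to g x, and so
   on; the n-th state is read off the n-th generation cell that contains u. *)
Section chain.
Variables (R : realType) (E : finType) (f : dist R E) (g : E -> dist R E).
Variable e0 : E.

Let cum (h : dist R E) (k : nat) : R := \sum_(y : E | (enum_rank y < k)%N) h y.

Let cumS h x : cum h (enum_rank x).+1 = cum h (enum_rank x) + h x.
Proof.
rewrite /cum (bigD1 x) ?ltnSn //= addrC; congr (_ + _).
apply: eq_bigl => y; rewrite ltnS leq_eqVlt.
by case: (eqVneq y x) => [->|yx]; rewrite ?eqxx ?ltnn ?andbF //= andbT
  (inj_eq val_inj) (inj_eq enum_rank_inj) (negbTE yx).
Qed.

Let cum_le h i j : (i <= j)%N -> cum h i <= cum h j.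
Proof.
move=> ij; rewrite /cum [leRHS](bigID (fun y : E => (enum_rank y < i)%N)) /=.
rewrite (eq_bigl (fun y : E => (enum_rank y < j)%N && (enum_rank y < i)%N)).
  by rewrite lerDl sumr_ge0 // => y _; exact: dist_ge0.
by move=> y; case: (ltnP (enum_rank y) i) => yi; rewrite ?andbF // (leq_trans yi).
Qed.

Let cum0 h : cum h 0 = 0.
Proof. by rewrite /cum big_pred0. Qed.

Let cumT h : cum h #|E| = 1.
Proof.
by rewrite -(dist_sum1 h) /cum; apply: eq_bigl => y; rewrite ltn_ord.
Qed.

Let cell (h : dist R E) (l w : R) (x : E) : set R :=
  [set` `[l + w * cum h (enum_rank x), l + w * cum h (enum_rank x) + w * h x[%R].

Let cellP h l w x u : (cell h l w x u) <->
  (l + w * cum h (enum_rank x) <= u < l + w * cum h (enum_rank x).+1).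
Proof. by rewrite /cell /= in_itv /= cumS mulrDr addrA. Qed.

Let cell_inj h (l w : R) x y u : 0 <= w -> cell h l w x u -> cell h l w y u -> x = y.
Proof.
move=> w0 /cellP/andP[x1 x2] /cellP/andP[y1 y2].
have key (a b : E) : l + w * cum h (enum_rank a) <= u ->
    u < l + w * cum h (enum_rank b).+1 -> (enum_rank a <= enum_rank b)%N.
  move=> ha hb; rewrite leqNgt; apply/negP => ba.
  have h1 : l + w * cum h (enum_rank b).+1 <= l + w * cum h (enum_rank a).
    by rewrite lerD2l; apply: ler_wpM2l => //; exact: cum_le.
  by have := lt_le_trans hb (le_trans h1 ha); rewrite ltxx.
apply: enum_rank_inj; apply: val_inj; apply/eqP.
by rewrite eqn_leq (key _ _ x1 y2) (key _ _ y1 x2).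
Qed.

Let cell_ex h (l w u : R) : l <= u < l + w -> exists x, cell h l w x u.
Proof.
move=> /andP[lu ul].
pose p k := u < l + w * cum h k.
have pT : p #|E| by rewrite /p cumT mulr1.
have [k pk kmin] := ex_minnP (ex_intro p #|E| pT).
have kE : (k <= #|E|)%N by exact: kmin.
case: k pk kE kmin => [|k] pk kE kmin.
  by move: pk; rewrite /p cum0 mulr0 addr0 ltNge lu.
exists (enum_val (Ordinal kE)); apply/cellP; rewrite enum_valK /=.
apply/andP; split => //; rewrite leNgt; apply/negP => pk'.
by have := kmin _ pk'; rewrite ltnn.
Qed.

Let cell_sub h (l w : R) x u : 0 <= w -> cell h l w x u -> l <= u < l + w.
Proof.
move=> w0 /cellP/andP[h1 h2]; apply/andP; split.
  apply: le_trans h1; rewrite lerDl mulr_ge0 // -(cum0 h); exact: cum_le.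
apply: (lt_le_trans h2); rewrite lerD2l -[leRHS]mulr1; apply: ler_wpM2l => //; rewrite -(cumT h).
exact: cum_le.
Qed.

Let next (h : dist R E) (l w u : R) : E := xget e0 [set x | cell h l w x u].

Let nextP h (l w u : R) : l <= u < l + w -> cell h l w (next h l w u) u.
Proof.
by move=> H; have [x cx] := cell_ex h H; rewrite /next; case: xgetP => [y ->|/(_ x)].
Qed.

Let shrink (h : dist R E) (x : E) (lw : R * R) : R * R :=
  (lw.1 + lw.2 * cum h (enum_rank x), lw.2 * h x).

Let Fixpoint state (n : nat) (u : R) : E * (R * R) :=
  if n is m.+1 then
    let: (x, lw) := state m u in
    let y := next (g x) lw.1 lw.2 u in (y, shrink (g x) y lw)
  else let x := next f 0 1 u in (x, shrink f x (0, 1)).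

Let Fixpoint path (n : nat) (x : nat -> E) : R * R :=
  if n is m.+1 then shrink (g (x m)) (x m.+1) (path m x)
  else shrink f (x 0%N) (0, 1).

Let in01 (u : R) := 0 <= u < 1.

Let X (n : nat) (u : R) : E := if in01 u then (state n u).1 else e0.

Let path_w n x : (path n x).2 = f (x 0%N) * \prod_(i < n) g (x i) (x i.+1).
Proof.
elim: n => [|n IH] /=; first by rewrite big_ord0 mulr1 mul1r.
by rewrite IH big_ord_recr /= mulrA.
Qed.

Let path_w0 n x : 0 <= (path n x).2.
Proof.
rewrite path_w mulr_ge0 ?dist_ge0 // prodr_ge0 // => i _; exact: dist_ge0.
Qed.

Let inpath n x u := (path n x).1 <= u < (path n x).1 + (path n x).2.

Let shrinkE h x lw u : cell h lw.1 lw.2 x u <->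
  ((shrink h x lw).1 <= u < (shrink h x lw).1 + (shrink h x lw).2).
Proof. by rewrite /cell /= in_itv. Qed.

Let inpath_state n x u : in01 u ->
  inpath n x u <-> (forall i, (i <= n)%N -> X i u = x i) /\
    (state n u) = (x n, path n x) .
Proof.
move=> u01; rewrite /X u01; elim: n => [|n IH].
  have cn : cell f 0 1 (next f 0 1 u) u by apply: nextP; rewrite add0r.
  split=> [|[H1 H2]].
    move=> /(shrinkE f (x 0%N) (0, 1) u).2 /= cx.
    have nx : next f 0 1 u = x 0%N by exact: cell_inj cn cx.
    by split=> [i|]; [rewrite leqn0 => /eqP -> | rewrite /= nx].
  have := H1 0%N isT => /= H.
  by rewrite /inpath /=; apply/(shrinkE f (x 0%N) (0,1)); rewrite -H.
split=> [|[H1 H2]].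
  move=> /(shrinkE (g (x n)) (x n.+1) (path n x) u).2 cx.
  have pn : inpath n x u by exact: cell_sub cx.
  have [H1 H2] := IH.1 pn.
  have cn := nextP (g (x n)) pn.
  have nx : next (g (x n)) (path n x).1 (path n x).2 u = x n.+1.
    exact: cell_inj cn cx.
  have Hn : state n.+1 u = (x n.+1, path n.+1 x) by rewrite /= H2 nx.
  split=> // i; rewrite leq_eqVlt => /orP[/eqP ->|]; last exact: H1.
  by rewrite Hn.
have S1 : state n u = (x n, path n x).
  have S0 k : (k <= n)%N -> state k u = (x k, path k x).
    elim: k => [|k IHk] kn.
      by have := H1 0%N isT; rewrite /= => ->.
    have := H1 k.+1 (ltnW (_ : k.+1 < n.+1)%N); rewrite /= IHk ?(ltnW kn) //=.
    by move=> ->.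
  exact: S0.
have pn : inpath n x u by apply/IH; split => // i ni; apply: H1; exact: ltnW.
have cn := nextP (g (x n)) pn.
have /= := H1 n.+1 (leqnn _); rewrite S1 /= => nx.
by rewrite nx in cn; apply/(shrinkE (g (x n)) (x n.+1) (path n x)).
Qed.

Let X_state n u : in01 u -> (state n u) = (X n u, path n (X^~ u)).
Proof.
move=> u01; rewrite /X u01; elim: n => [//|n IH].
by rewrite /=; case: (state n u) IH => y lw /= [->].
Qed.

Let X_path n x u : in01 u ->
  inpath n x u <-> (forall i, (i <= n)%N -> X i u = x i).
Proof.
move=> u01; rewrite inpath_state //; split=> [[]//|H]; split=> //.
rewrite X_state // (H n) //; congr (_, _).
elim: n H => [|n IH] H /=; first by rewrite H.
by rewrite !H // IH // => i ni; apply: H; exact: ltnW.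
Qed.

Let inpath01 n x u : inpath n x u -> in01 u.
Proof.
elim: n => [|n IH].
  by move=> /(shrinkE f (x 0%N) (0, 1) u).2/cell_sub; rewrite /in01 add0r; apply.
by move=> /(shrinkE (g (x n)) (x n.+1) (path n x) u).2/cell_sub c; apply/IH/c.
Qed.

Let cyl_set n x : [set u | forall i, (i <= n)%N -> X i u = x i] =
  [set u | inpath n x u] `|`
  ([set u | ~~ in01 u] `&` [set u | forall i, (i <= n)%N -> e0 = x i]).
Proof.
apply/seteqP; split=> u /=.
  move=> H; have [u01|u01] := boolP (in01 u); [left | right].
    exact/X_path.
  by split=> // i ni; rewrite -H // /X (negbTE u01).
move=> [ip|[u01 H] i ni]; first by apply/X_path => //; exact: inpath01 ip.
by rewrite /X (negbTE u01); exact: H.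
Qed.

Let inpathE n x : [set u | inpath n x u] =
  [set` `[(path n x).1, (path n x).1 + (path n x).2[%R].
Proof. by apply/seteqP; split=> u /=; rewrite in_itv. Qed.

Let in01E : [set u | ~~ in01 u] = ~` [set` `[0, 1[%R].
Proof. by apply/seteqP; split=> u /=; rewrite in_itv /= => /negP. Qed.

Let mout n x : measurable
  ([set u | ~~ in01 u] `&` [set u | forall i, (i <= n)%N -> e0 = x i]).
Proof.
rewrite in01E; apply: measurableI; first exact: measurableC.
have [H|H] := pselect (forall i, (i <= n)%N -> e0 = x i).
  by rewrite [X in measurable X](_ : _ = setT) //; apply/seteqP; split.
by rewrite [X in measurable X](_ : _ = set0) //; apply/seteqP; split.
Qed.

Let mcyl n x : measurable [set u | forall i, (i <= n)%N -> X i u = x i].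
Proof.
by rewrite cyl_set; apply: measurableU; [rewrite inpathE | exact: mout].
Qed.

Let shrink_sub h x (lw : R * R) : 0 <= lw.2 -> lw.1 <= (shrink h x lw).1 /\
  (shrink h x lw).1 + (shrink h x lw).2 <= lw.1 + lw.2.
Proof.
move=> w0; split=> /=.
  by rewrite lerDl mulr_ge0 // -(cum0 h); exact: cum_le.
rewrite -addrA -mulrDr -cumS lerD2l -[leRHS]mulr1; apply: ler_wpM2l => //.
by rewrite -(cumT h); exact: cum_le.
Qed.

Let path_sub n x :
  0 <= (path n x).1 /\ (path n x).1 + (path n x).2 <= 1.
Proof.
elim: n => [|n [IH1 IH2]]; first by
  have := @shrink_sub f (x 0%N) (0, 1) ler01; rewrite /= !add0r.
have [H1 H2] := @shrink_sub (g (x n)) (x n.+1) (path n x) (path_w0 n x).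
by split; [exact: le_trans H1 | exact: le_trans IH2].
Qed.

Lemma chain_exists : exists X : nat -> R -> E,
  (forall n x, measurable [set u | X n u = x]) /\
  (forall n (x : nat -> E),
    uniform_prob (@ltr01 R) [set u | forall i, (i <= n)%N -> X i u = x i] =
    (f (x 0%N) * \prod_(i < n) g (x i) (x i.+1))%:E).
Proof.
exists X; split=> n x.
  have -> : [set u | X n u = x] =
      \bigcup_(h in [set h : {ffun 'I_n.+1 -> E} | h ord_max = x])
      [set u | forall i, (i <= n)%N -> X i u = h (inord i)].
    apply/seteqP; split=> u /=.
      move=> Xx; exists [ffun i : 'I_n.+1 => X i u]; first by rewrite /= ffunE.
      by move=> i ni; rewrite ffunE inordK.
    move=> [h /= <-] H; rewrite (H n (leqnn n)); congr (h _).
    by apply: val_inj; rewrite /= inordK.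
  apply: fin_bigcup_measurable => [|h _]; first exact: finite_finset.
  exact: (mcyl n (fun i => h (inord i))).
have [p0 p1] := path_sub n x.
rewrite -path_w cyl_set measureU; last 3 first.
- by rewrite inpathE.
- exact: mout.
- apply/seteqP; split=> // u [/= ip [/negP]]; case; exact: inpath01 ip.
rewrite [X in (_ + X)%E](_ : _ = 0%E); last first.
  apply/eqP; rewrite eq_le measure_ge0 andbT.
  apply: (@le_trans _ _ (uniform_prob (@ltr01 R) (~` [set` `[0, 1[%R]))).
    apply: le_measure; rewrite ?inE; [exact: mout | exact: measurableC |].
    by rewrite in01E => u [].
  rewrite /uniform_prob integral_uniform_pdf.
  rewrite (_ : _ `&` _ = [set 1]); first by rewrite integral_set1.
  apply/seteqP; split=> u /=; rewrite !in_itv /=.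
    by move=> [/negP]; rewrite negb_and -!ltNge -leNgt => /orP[u0|u1] /andP[h1 h2];
       [move: (lt_le_trans u0 h1); rewrite ltxx | apply/eqP; rewrite eq_le u1 h2].
  by move=> ->; rewrite ltxx andbF ler01 lexx; split.
rewrite adde0 inpathE -[LHS]/(uniform_prob (@ltr01 R) _) /uniform_prob integral_uniform_pdf setIidl; last first.
  by move=> u /=; rewrite !in_itv /= => /andP[h1 h2];
     rewrite (le_trans p0 h1) (ltW (lt_le_trans h2 p1)).
rewrite (eq_integral (cst 1%E)); last first.
  move=> u; rewrite inE /= in_itv /= => /andP[h1 h2]; rewrite /uniform_pdf.
  by rewrite (le_trans p0 h1) (ltW (lt_le_trans h2 p1)) subr0 invr1.
rewrite integral_cst // mul1e.
rewrite [LHS](lebesgue_measure_itv `[_, _[%R) /= lte_fin ltrDl.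
case: ltgtP (path_w0 n x) => // [w0|<-] _.
  by rewrite -EFinD addrAC subrr add0r.
by [].
Qed.

End chain.

Definition step_fun (R : realType) (S A : finType) (P : S -> A -> dist R S)
  (pi : S -> dist R A) (x y : S * A) : R := P x.1 x.2 y.1 * pi y.1 y.2.

Lemma step_fun_ge0 (R : realType) (S A : finType) (P : S -> A -> dist R S)
  (pi : S -> dist R A) (x y : S * A) : 0 <= step_fun P pi x y.
Proof. by rewrite mulr_ge0 ?dist_ge0. Qed.

Lemma step_fun_sum1 (R : realType) (S A : finType) (P : S -> A -> dist R S)
  (pi : S -> dist R A) (x : S * A) : \sum_y step_fun P pi x y = 1.
Proof.
transitivity (\sum_s \sum_a step_fun P pi x (s, a)).
  by rewrite pair_bigA; apply: eq_bigr => -[].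
rewrite -[RHS](dist_sum1 (P x.1 x.2)); apply: eq_bigr => s _.
by rewrite /step_fun /= -mulr_sumr dist_sum1 mulr1.
Qed.

Lemma trajectory_exists (R : realType) (S A : finType)
    (P : S -> A -> dist R S) (pi : S -> dist R A) (init : dist R (S * A)%type) :
  exists X : nat -> R -> S * A,
    is_trajectory P pi init (uniform_prob (@ltr01 R)) X.
Proof.
have [e0 _|E0] := pickP (xpredT : pred (S * A)%type); last first.
  by have := dist_sum1 init; rewrite big_pred0 // => /eqP; rewrite eq_sym oner_eq0.
exact: (chain_exists init
  (fun x => Dist (step_fun_ge0 P pi x) (step_fun_sum1 P pi x)) e0).
Qed.

(* Any process with this law would do: only expectations of functions of the
   trajectory are taken below, and trajectoryP is all that is known of it. *)
Definition trajectory (R : realType) (S A : finType)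
    (P : S -> A -> dist R S) (pi : S -> dist R A) (init : dist R (S * A)%type) :
    nat -> R -> S * A :=
  sval (cid (trajectory_exists P pi init)).

Lemma trajectoryP (R : realType) (S A : finType)
    (P : S -> A -> dist R S) (pi : S -> dist R A) (init : dist R (S * A)%type) :
  is_trajectory P pi init (uniform_prob (@ltr01 R)) (trajectory P pi init).
Proof. exact: svalP (cid (trajectory_exists P pi init)). Qed.

Definition discounted_return (R : realType) (S A : finType) (r : S -> A -> R)
    (gamma : R) (x : nat -> S * A) : R :=
  limn (series (fun t => gamma ^+ t * r (x t).1 (x t).2)).

Definition Qvalue (R : realType) (S A : finType) (P : S -> A -> dist R S)
    (r : S -> A -> R) (gamma : R) (pi : S -> dist R A) (s : S) (a : A) : R :=
  fine 'E_(uniform_prob (@ltr01 R))[fun u => discounted_return r gamma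
    (fun t => trajectory P pi (dirac_dist R (s, a)) t u)].

(* The set is bounded when 0 <= r <= 1 and 0 <= gamma < 1, and its sup is the
   maximum over the policies. *)
Definition Qstar (R : realType) (S A : finType) (P : S -> A -> dist R S)
    (r : S -> A -> R) (gamma : R) (s : S) (a : A) : R :=
  sup (range (fun pi : S -> dist R A => Qvalue P r gamma pi s a)).

(* The whole run uses one trajectory x: batch k occupies the times
   batch_start B k, ..., batch_start B k + B k - 1, so that the last state
   s_{B_k}^k of batch k and the first state s_0^{k+1} of the next one are the
   same entry of x. *)
Definition batch_start (B : nat -> nat) (k : nat) : nat :=
  (\sum_(j < k) B j)%N.

Definition td_error (R : realType) (S A : finType) (r : S -> A -> R)
    (gamma : R) (Q : S -> A -> R) (st : S) (at_ : A) (st1 : S) : R :=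
  r st at_ + gamma * fmax (Q st1) - Q st at_.

Fixpoint batch_Q (R : realType) (S A : finType) (r : S -> A -> R) (gamma : R)
    (alpha : nat -> R) (B : nat -> nat) (c : nat -> nat -> R)
    (x : nat -> S * A) (k : nat) : S -> A -> R :=
  if k is j.+1 then
    let Q := batch_Q r gamma alpha B c x j in
    fun s a => Q s a + alpha j * \sum_(t < B j)
      c j t * (let n := (batch_start B j + t)%N in
               if x n == (s, a)
               then td_error r gamma Q (x n).1 (x n).2 (x n.+1).1 else 0)
  else fun _ _ => 0.

Definition policy_kernel (R : realType) (S A : finType)
    (P : S -> A -> dist R S) (pi : S -> dist R A) (s s' : S) : R :=
  \sum_a pi s a * P s a s'.

Fixpoint nstep (R : realType) (S : finType) (M : S -> S -> R) (n : nat)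
    (s s' : S) : R :=
  if n is m.+1 then \sum_s1 nstep M m s s1 * M s1 s' else (s == s')%:R.

Definition irreducible_chain (R : realType) (S : finType) (M : S -> S -> R) :
    Prop :=
  forall s s', exists n, 0 < nstep M n s s'.

(* For every s the gcd of the return times n > 0 with M^n(s, s) > 0 is 1. *)
Definition aperiodic_chain (R : realType) (S : finType) (M : S -> S -> R) :
    Prop :=
  forall s (d : nat),
    (forall n, (0 < n)%N -> 0 < nstep M n s s -> (d %| n)%N) -> d = 1%N.

Definition ergodic_chain (R : realType) (S : finType) (M : S -> S -> R) :
    Prop :=
  irreducible_chain M /\ aperiodic_chain M.

Definition stationary (R : realType) (S : finType) (M : S -> S -> R)
    (nu : S -> R) : Prop :=
  forall s', \sum_s nu s * M s s' = nu s'.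

Definition tv_dist (R : realType) (S : finType) (mu nu : S -> R) : R :=
  2^-1 * \sum_s `|mu s - nu s|.

(* The bound on P(s_{n+t} = . | s_n = s) does not involve n, the chain
   being homogeneous. *)
Definition mixes_at_rate (R : realType) (S : finType) (M : S -> S -> R)
    (nu : S -> R) (m kappa : R) : Prop :=
  forall s t, tv_dist nu (nstep M t s) <= m * kappa ^+ t.

Definition min_prob (R : realType) (S A : finType) (pi : S -> dist R A) : R :=
  fmin (fun x : S * A => pi x.1 x.2).

Definition min_occupation (R : realType) (S A : finType) (nu : S -> R)
    (pi : S -> dist R A) : R :=
  fmin (fun x : S * A => nu x.1 * pi x.1 x.2).

Definition Xi (R : realType) (rho : R) (B : nat -> nat) (t : nat) : R :=
  \sum_(k < t) rho ^+ (t - 1 - k) * (Num.sqrt (B k)%:R)^-1.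

(* Main.v *)
(* The optimal value solves the Bellman equation Q* = T Q*. Off a noise term w_k,
   one batch moves Q^k to Q^k + alpha sigma (T Q^k - Q^k), sigma being the
   stationary occupation measure; this is a sup-norm contraction towards Q* with
   factor rho, so |Q* - Q^K| is at most
     rho^K / (1 - gamma) + alpha sum_k rho^(K-1-k) |w_k|
   along every trajectory. The noise w_k is the batch average of terms that are
   bounded by 2 / (1 - gamma), and the term at lag d + 1, given what precedes
   it, has mean at most m kappa^d / (1 - gamma) because it is centred at the
   stationary law. Summing these correlations gives
     E |w_k|_2^2 <= 4 |S| |A| / (1 - gamma)^2 (1 + m / (1 - kappa)) / B_k,
   and Jensen's inequality bounds E |w_k| by the square root. *)
Require Import Defs.
From mathcomp Require Import all_boot all_order all_algebra.
From mathcomp Require Import all_classical all_reals all_analysis.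
From mathcomp Require Import measurable_realfun.
From mathcomp Require Import ring lra zify.

Set Implicit Arguments.
Unset Strict Implicit.
Unset Printing Implicit Defensive.

Import Order.TTheory GRing.Theory Num.Theory.
Import numFieldNormedType.Exports.

Local Open Scope ring_scope.

(** * Finite averages and conditional expectations along a chain *)

Section finite_extrema.
Context {R : realType} {T : finType}.
Implicit Types f g : T -> R.

Lemma fmax_ge f x : f x <= fmax f.
Proof. by have [_] := fmaxP f x; apply. Qed.

Lemma fmax_le f c (x0 : T) : (forall x, f x <= c) -> fmax f <= c.
Proof. by have [[x ->] _] := fmaxP f x0. Qed.

Lemma le_fmax f g (x0 : T) : (forall x, f x <= g x) -> fmax f <= fmax g.
Proof. by move=> fg; apply: fmax_le x0 _ => x; exact: le_trans (fmax_ge g x). Qed.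

Lemma fmax_lipschitz f g c (x0 : T) :
  (forall x, `|f x - g x| <= c) -> `|fmax f - fmax g| <= c.
Proof.
move=> fg; rewrite ler_norml; apply/andP; split.
  suff : fmax g <= fmax f + c by lra.
  by apply: fmax_le x0 _ => x; have := fmax_ge f x; move: (fg x); rewrite ler_norml; lra.
rewrite lerBlDr.
by apply: fmax_le x0 _ => x; have := fmax_ge g x; move: (fg x); rewrite ler_norml; lra.
Qed.

End finite_extrema.

Section averages.
Context {R : realType} {T : finType}.
Variable p : dist R T.
Implicit Types f g : T -> R.

Lemma dist_le1 x : p x <= 1.
Proof.
rewrite -(dist_sum1 p) (bigD1 x) //= lerDl.
by apply: sumr_ge0 => y _; exact: dist_ge0.
Qed.

Lemma dist_avg_cst c : \sum_x p x * c = c.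
Proof. by rewrite -mulr_suml dist_sum1 mul1r. Qed.

Lemma le_dist_avg f g : (forall x, f x <= g x) ->
  \sum_x p x * f x <= \sum_x p x * g x.
Proof. by move=> fg; apply: ler_sum => x _; rewrite ler_wpM2l ?dist_ge0. Qed.

Lemma dist_avg_le f c : (forall x, f x <= c) -> \sum_x p x * f x <= c.
Proof. by move=> fc; rewrite -[leRHS]dist_avg_cst; exact: le_dist_avg. Qed.

Lemma dist_avg_ge f c : (forall x, c <= f x) -> c <= \sum_x p x * f x.
Proof. by move=> fc; rewrite -[leLHS]dist_avg_cst; exact: le_dist_avg. Qed.

Lemma dist_avg_norm f c : (forall x, `|f x| <= c) -> `|\sum_x p x * f x| <= c.
Proof.
move=> fc; rewrite ler_norml dist_avg_le ?dist_avg_ge // => x;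
  by move: (fc x); rewrite ler_norml => /andP[].
Qed.

End averages.

Section conditional_expectation.
Context {R : realType} {E : finType}.
Variable g : E -> dist R E.
Implicit Types (x y : nat -> E) (h : (nat -> E) -> R).

Definition upd x n (e : E) : nat -> E := fun i => if i == n then e else x i.

Lemma upd_eq x n e : upd x n e n = e.
Proof. by rewrite /upd eqxx. Qed.

Lemma upd_lt x n e i : (i < n)%N -> upd x n e i = x i.
Proof. by move=> ni; rewrite /upd ltn_eqF. Qed.

Definition agree n x y := forall i, (i <= n)%N -> x i = y i.

Lemma agreeW m n x y : (m <= n)%N -> agree n x y -> agree m x y.
Proof. by move=> mn xy i im; apply: xy; exact: leq_trans mn. Qed.

(* The expectation of h given the path x up to time n, when the path is
   resampled at times n + 1, ..., n + k. *)
Fixpoint cexp k n x h : R :=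
  if k is k'.+1 then \sum_e g (x n) e * cexp k' n.+1 (upd x n.+1 e) h else h x.

Lemma cexpS k n x h :
  cexp k.+1 n x h = \sum_e g (x n) e * cexp k n.+1 (upd x n.+1 e) h.
Proof. by []. Qed.

(** Resampling only overwrites entries after time [n], so comparing on continuations of [x]
    suffices; this is how knowledge of the past enters a conditional expectation. *)
Lemma le_cexp_agree k n x h1 h2 :
  (forall y, agree n y x -> h1 y <= h2 y) -> cexp k n x h1 <= cexp k n x h2.
Proof.
elim: k n x => [|k IH] n x H /=; first exact: H.
apply: le_dist_avg => e; apply: IH => y yx; apply: H => i ni.
by rewrite yx ?upd_lt // ltnW.
Qed.

Lemma le_cexp k n x h1 h2 : (forall y, h1 y <= h2 y) ->
  cexp k n x h1 <= cexp k n x h2.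
Proof. by move=> H; apply: le_cexp_agree => y _. Qed.

Lemma eq_cexp_agree k n x h1 h2 :
  (forall y, agree n y x -> h1 y = h2 y) -> cexp k n x h1 = cexp k n x h2.
Proof.
by move=> H; apply/eqP; rewrite eq_le !le_cexp_agree // => y /H ->.
Qed.

Lemma cexpD k n x h1 h2 :
  cexp k n x (fun y => h1 y + h2 y) = cexp k n x h1 + cexp k n x h2.
Proof.
elim: k n x => [//|k IH] n x /=.
by rewrite -big_split; apply: eq_bigr => e _; rewrite /= IH mulrDr.
Qed.

Lemma cexpZ k n x c h : cexp k n x (fun y => c * h y) = c * cexp k n x h.
Proof.
elim: k n x => [//|k IH] n x /=.
by rewrite mulr_sumr; apply: eq_bigr => e _; rewrite /= IH mulrCA.
Qed.

Lemma cexp_cst k n x c : cexp k n x (fun=> c) = c.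
Proof.
elim: k n x => [//|k IH] n x /=.
by rewrite (eq_bigr _ (fun e _ => congr1 _ (IH _ _))) dist_avg_cst.
Qed.

Lemma cexp_sum k n x I (s : seq I) (P : pred I) (F : I -> (nat -> E) -> R) :
  cexp k n x (fun y => \sum_(i <- s | P i) F i y) =
  \sum_(i <- s | P i) cexp k n x (F i).
Proof.
elim: s => [|i s IH].
  rewrite big_nil -[RHS](cexp_cst k n x 0); apply: eq_cexp_agree => y _.
  by rewrite big_nil.
rewrite big_cons -IH; case: ifP => Pi; last first.
  by apply: eq_cexp_agree => y _; rewrite big_cons Pi.
by rewrite -cexpD; apply: eq_cexp_agree => y _; rewrite big_cons Pi.
Qed.

Lemma cexp_known k n x c h1 h2 : (forall y, agree n y x -> h1 y = c * h2 y) ->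
  cexp k n x h1 = c * cexp k n x h2.
Proof. by move=> H; rewrite -cexpZ; exact: eq_cexp_agree. Qed.

Lemma cexp_tower j k n x h :
  cexp (j + k) n x h = cexp j n x (fun y => cexp k (n + j) y h).
Proof.
elim: j n x => [|j IH] n x; first by rewrite add0n /= addn0.
by rewrite addSn /=; apply: eq_bigr => e _; rewrite IH addSnnS.
Qed.

Lemma cexp_le k n x h c : (forall y, agree n y x -> h y <= c) -> cexp k n x h <= c.
Proof. by move=> H; rewrite -[leRHS](cexp_cst k n x); exact: le_cexp_agree. Qed.

Lemma cexp_norm k n x h c :
  (forall y, agree n y x -> `|h y| <= c) -> `|cexp k n x h| <= c.
Proof.
move=> H; rewrite ler_norml cexp_le ?andbT => [|y /H]; last first.
  by rewrite ler_norml => /andP[].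
rewrite -[leLHS](cexp_cst k n x); apply: le_cexp_agree => y /H.
by rewrite ler_norml => /andP[].
Qed.

(* Jensen: expand [0 <= E (h - E h)^2]. *)
Lemma cexp_le_sqrt k n x h :
  cexp k n x h <= Num.sqrt (cexp k n x (fun y => h y ^+ 2)).
Proof.
set c := cexp k n x h; apply: le_trans (ler_norm c) _.
rewrite -sqrtr_sqr ler_wsqrtr //.
have : 0 <= cexp k n x (fun y => (h y ^+ 2 + - 2 * c * h y) + c ^+ 2).
  rewrite -[leLHS](cexp_cst k n x); apply: le_cexp => y.
  by rewrite (_ : _ + _ = (h y - c) ^+ 2) ?sqr_ge0 //; ring.
by rewrite !cexpD cexpZ cexp_cst -/c; lra.
Qed.

(** [nstep] appends its last step whereas [cexp] peels off the first one; this recursion has the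
    shape of the latter. *)
Lemma nstep_recl n e e' :
  nstep (fun e e' => g e e') n.+1 e e' = \sum_e1 g e e1 * nstep (fun e e' => g e e') n e1 e'.
Proof.
elim: n e' => [|n IH] e'.
  rewrite /= (bigD1 e) //= [RHS](bigD1 e') //= !eqxx mul1r mulr1.
  rewrite !big1 // => i /negbTE ni; rewrite ?ni ?mulr0 //.
  by rewrite eq_sym ni mul0r.
rewrite [LHS]/= (eq_bigr _ (fun s _ => congr1 ( *%R^~ _) (IH s))) /=.
under eq_bigr do rewrite mulr_suml.
rewrite exchange_big; apply: eq_bigr => e1 _ /=; rewrite mulr_sumr.
by apply: eq_bigr => e2 _; rewrite mulrA.
Qed.

(** The trailing [k] steps integrate out, so the entry at time [n + j] has a row of the [j]-step
    matrix as its law. *)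
Lemma cexp_nstep j k n x (f : E -> R) :
  cexp (j + k) n x (fun y => f (y (n + j)%N)) =
  \sum_e nstep (fun e e' => g e e') j (x n) e * f e.
Proof.
elim: j n x => [|j IH] n x.
  rewrite add0n addn0 /=.
  transitivity (cexp k n x (fun=> f (x n))).
    by apply: eq_cexp_agree => y yx; rewrite yx.
  rewrite cexp_cst (bigD1 (x n)) //= eqxx mul1r big1 ?addr0 // => e ne.
  by rewrite eq_sym (negbTE ne) mul0r.
rewrite addSn cexpS.
transitivity (\sum_e g (x n) e *
    \sum_e' nstep (fun e e' => g e e') j e e' * f e').
  apply: eq_bigr => e _; rewrite -addSnnS IH upd_eq //.
under [RHS]eq_bigr do rewrite nstep_recl mulr_suml.
rewrite exchange_big; apply: eq_bigr => e _ /=; rewrite mulr_sumr.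
by apply: eq_bigr => e1 _; rewrite mulrA.
Qed.

End conditional_expectation.

(** * Expectations over a trajectory *)

Definition step_dist (R : realType) (S A : finType) (P : S -> A -> dist R S)
    (pi : S -> dist R A) (x : S * A) : dist R (S * A)%type :=
  Dist (step_fun_ge0 P pi x) (step_fun_sum1 P pi x).
Arguments step_dist : simpl never.

Section trajectory_expectation.
Local Open Scope classical_set_scope.
Context {R : realType} {S A : finType}.
Variables (P : S -> A -> dist R S) (pi : S -> dist R A).
Variable init : dist R (S * A)%type.
Context {d : measure_display} {Omega : measurableType d}.
Variables (Pr : probability Omega R) (X : nat -> Omega -> S * A).
Hypothesis XP : is_trajectory P pi init Pr X.
Let g := step_dist P pi.
Implicit Types (x : nat -> S * A) (h : (nat -> S * A) -> R).

Definition cylinder n x := [set w | forall t, (t <= n)%N -> X t w = x t].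

Lemma measurable_cylinder n x : measurable (cylinder n x).
Proof.
have [mX _] := XP; elim: n => [|n IH].
  rewrite (_ : cylinder 0 x = [set w | X 0%N w = x 0%N]); first exact: mX.
  by apply/seteqP; split => w /= H; [apply: H | move=> t; rewrite leqn0 => /eqP ->].
rewrite (_ : cylinder n.+1 x = cylinder n x `&` [set w | X n.+1 w = x n.+1]).
  by apply: measurableI => //; exact: mX.
apply/seteqP; split => w /=.
  by move=> H; split => [t tn|]; apply: H => //; exact: leqW.
by move=> [H1 H2] t; rewrite leq_eqVlt => /orP[/eqP -> //|]; exact: H1.
Qed.

Lemma cylinderS n x :
  cylinder n x = \big[setU/set0]_(e <- enum {: S * A}) cylinder n.+1 (upd x n.+1 e).
Proof.
rewrite -bigcup_seq; apply/seteqP; split => w /=.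
  move=> H; exists (X n.+1 w); first by rewrite /= mem_enum.
  move=> t; rewrite leq_eqVlt => /orP[/eqP ->|tn]; first by rewrite upd_eq.
  by rewrite upd_lt // H.
by move=> [e _ H] t tn; rewrite H ?upd_lt // leqW.
Qed.

Lemma cylinder_start :
  setT = \big[setU/set0]_(e <- enum {: S * A}) cylinder 0 (fun=> e).
Proof.
rewrite -bigcup_seq; apply/seteqP; split => w //= _.
exists (X 0%N w); first by rewrite /= mem_enum.
by move=> t; rewrite leqn0 => /eqP ->.
Qed.

Lemma probability_cylinderS n x e : Pr (cylinder n.+1 (upd x n.+1 e)) =
  (Pr (cylinder n x) * (g (x n) e)%:E)%E.
Proof.
have [_ XPr] := XP; rewrite !XPr big_ord_recr /= -EFinM mulrA.
rewrite (upd_lt x e (ltn0Sn n)) (upd_lt x e (ltnSn n)) upd_eq.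
congr (_ * _ * _)%:E; apply: eq_bigr => -[i /= ni] _.
have in1 : (i < n.+1)%N by exact: leqW.
by rewrite (upd_lt x e in1) (@upd_lt _ x n.+1 e i.+1 ni).
Qed.

Definition finite_horizon N h := forall x y, agree N x y -> h x = h y.

(** There are finitely many path prefixes up to time [N], so each preimage is a finite union of
    cylinders. *)
Lemma measurable_finite_horizon N h : finite_horizon N h ->
  measurable_fun setT (fun w => h (X^~ w)).
Proof.
move=> hN _ Y mY; rewrite setTI.
pose ext (p : {ffun 'I_N.+1 -> S * A}) i := p (inord i).
rewrite [Z in measurable Z](_ : _ =
    \bigcup_(p in [set p | Y (h (ext p))]) cylinder N (ext p)).
  apply: fin_bigcup_measurable => [|p _]; first exact: finite_finset.
  exact: measurable_cylinder.
apply/seteqP; split => w /=.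
  move=> Yw; pose p := [ffun i : 'I_N.+1 => X i w].
  have wp : agree N (X^~ w) (ext p) by move=> t tN; rewrite /ext ffunE inordK.
  by exists p => //=; rewrite -(hN _ _ wp).
by move=> [p /= Yp] /hN ->.
Qed.

(** Induction on the number of unobserved steps: a cylinder splits disjointly by the next pair, and
    each piece carries its transition weight, which is the recursion of [cexp]. *)
Lemma integral_cylinder N h k n x : (forall y, 0 <= h y) -> finite_horizon N h ->
  (n + k)%N = N ->
  (\int[Pr]_(w in cylinder n x) (h (X^~ w))%:E =
   Pr (cylinder n x) * (cexp g k n x h)%:E)%E.
Proof.
move=> h0 hN; elim: k n x => [|k IH] n x nk.
  rewrite (eq_integral (cst (h x)%:E)) => [|w].
    by rewrite integral_cst; [rewrite muleC | exact: measurable_cylinder].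
  rewrite inE => wx; congr _%:E; apply: hN; rewrite -nk addn0; exact: wx.
have mh D : measurable_fun D (fun w => (h (X^~ w))%:E).
  by apply/measurable_EFinP; apply: measurable_funTS (measurable_finite_horizon hN).
rewrite {1}cylinderS ge0_integral_bigsetU //=; last 4 first.
- by move=> e; exact: measurable_cylinder.
- exact: enum_uniq.
- move=> e1 e2 _ _ [w [/= /(_ n.+1 (leqnn _))]] H1 /(_ n.+1 (leqnn _)).
  by rewrite H1 !upd_eq.
- by move=> w _; rewrite lee_fin.
rewrite big_enum /= -sumEFin ge0_sume_distrr; last first.
  move=> e _; rewrite lee_fin mulr_ge0 // ?step_fun_ge0 //.
  rewrite -[leLHS](cexp_cst g k n.+1 (upd x n.+1 e) 0).
  by apply: le_cexp => y; exact: h0.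
apply: eq_bigr => e _; rewrite IH ?addSnnS // EFinM muleA.
by rewrite probability_cylinderS.
Qed.

(** Bridge from integrals to finite sums: afterwards a bound on [cexp] uniform in the initial pair
    is enough. *)
Lemma expectation_finite_horizon N h :
  (forall y, 0 <= h y) -> finite_horizon N h ->
  'E_Pr[fun w => h (X^~ w)]%E = (\sum_e init e * cexp g N 0 (fun=> e) h)%:E.
Proof.
move=> h0 hN; rewrite unlock.
have mh D : measurable_fun D (fun w => (h (X^~ w))%:E).
  by apply/measurable_EFinP; apply: measurable_funTS (measurable_finite_horizon hN).
rewrite cylinder_start ge0_integral_bigsetU //=; last 4 first.
- by move=> e; exact: measurable_cylinder.
- exact: enum_uniq.
- by move=> e1 e2 _ _ [w [/= /(_ 0%N (leqnn _)) <- /(_ 0%N (leqnn _)) <-]].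
- by move=> w _; rewrite lee_fin.
rewrite big_enum /= -sumEFin; apply: eq_bigr => e _.
rewrite (integral_cylinder (k := N) _ h0 hN) // EFinM; congr (_ * _)%E.
have [_ XPr] := XP; rewrite /cylinder XPr.
by rewrite big_ord0 mulr1.
Qed.

End trajectory_expectation.

(** * The optimal value function *)

Definition bellman (R : realType) (S A : finType) (P : S -> A -> dist R S)
    (r : S -> A -> R) (gamma : R) (Q : S -> A -> R) (s : S) (a : A) : R :=
  r s a + gamma * \sum_s' P s a s' * fmax (Q s').

Section optimality.
Local Open Scope classical_set_scope.
Context {R : realType} {S A : finType}.
Variables (P : S -> A -> dist R S) (r : S -> A -> R) (gamma : R) (a0 : A).
Hypothesis r01 : forall s a, 0 <= r s a <= 1.
Hypothesis gamma01 : 0 <= gamma < 1.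
Implicit Types Q : S -> A -> R.

Let T := bellman P r gamma.
Let vmax := (1 - gamma)^-1.

Let gamma_ge0 : 0 <= gamma. Proof. by case/andP: gamma01. Qed.

Lemma vmax_gt0 : 0 < vmax.
Proof. by rewrite invr_gt0 subr_gt0; case/andP: gamma01. Qed.

Lemma vmax_fix : 1 + gamma * vmax = vmax.
Proof.
have : 1 - gamma != 0 by rewrite subr_eq0 eq_sym lt_eqF //; case/andP: gamma01.
by rewrite /vmax => ?; field.
Qed.

Lemma le_bellman Q1 Q2 s a : (forall s a, Q1 s a <= Q2 s a) -> T Q1 s a <= T Q2 s a.
Proof.
move=> Q12; rewrite lerD2l ler_wpM2l // le_dist_avg // => s'.
exact: le_fmax.
Qed.

Lemma bellman_ge0 Q s a : (forall s a, 0 <= Q s a) -> 0 <= T Q s a.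
Proof.
move=> Q0; rewrite addr_ge0 ?mulr_ge0 ?dist_avg_ge //; first by case/andP: (r01 s a).
by move=> s'; apply: le_trans (fmax_ge _ a0).
Qed.

Definition subsolution Q := forall s a, Q s a <= T Q s a.

(** The maximum [c] of a subsolution satisfies [c <= 1 + gamma * c], and [vmax] is the case of
    equality. *)
Lemma subsolution_le_vmax Q s a : subsolution Q -> Q s a <= vmax.
Proof.
move=> sub; pose c := fmax (fun x : S * A => Q x.1 x.2).
have Qc s' a' : Q s' a' <= c := fmax_ge (fun x : S * A => Q x.1 x.2) (s', a').
suff : c <= vmax by exact: le_trans.
have : c <= 1 + gamma * c.
  apply: fmax_le (s, a) _ => -[s1 a1] /=; apply: le_trans (sub s1 a1) _.
  rewrite lerD ?ler_wpM2l ?dist_avg_le //; first by case/andP: (r01 s1 a1).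
  by move=> s'; apply: fmax_le.
move=> cle; rewrite /vmax -[leRHS]mul1r ler_pdivlMr ?subr_gt0; last by case/andP: gamma01.
lra.
Qed.

(* The Knaster-Tarski fixed point of the monotone map T. *)
Definition value_fixpoint s a := sup [set Q s a | Q in subsolution].

Lemma value_fixpoint_ub Q s a : subsolution Q -> Q s a <= value_fixpoint s a.
Proof.
move=> sub; apply: ub_le_sup; last by exists Q.
by exists vmax => _ [Q' sub' <-]; exact: subsolution_le_vmax.
Qed.

Lemma subsolution0 : subsolution (fun _ _ => 0).
Proof. by move=> s a; exact: bellman_ge0. Qed.

Lemma value_fixpoint_le s a c :
  (forall Q, subsolution Q -> Q s a <= c) -> value_fixpoint s a <= c.
Proof.
move=> H; apply: ge_sup; first by exists 0, (fun _ _ => 0); [exact: subsolution0 |].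
by move=> _ [Q sub <-]; exact: H.
Qed.

Lemma value_fixpointE s a : value_fixpoint s a = T value_fixpoint s a.
Proof.
have le s' a' : value_fixpoint s' a' <= T value_fixpoint s' a'.
  apply: value_fixpoint_le => Q sub; apply: le_trans (sub s' a') _.
  by apply: le_bellman => s1 a1; exact: value_fixpoint_ub.
apply/eqP; rewrite eq_le le /=.
(* By monotonicity [T value_fixpoint] is itself a subsolution, hence lies below the supremum. *)
by apply: (value_fixpoint_ub (Q := T value_fixpoint)) => s' a'; exact: le_bellman.
Qed.

Lemma value_fixpoint_ge0 s a : 0 <= value_fixpoint s a.
Proof. exact: (value_fixpoint_ub s a subsolution0). Qed.

Lemma value_fixpoint_le_vmax s a : value_fixpoint s a <= vmax.
Proof. by apply: value_fixpoint_le => Q sub; exact: subsolution_le_vmax. Qed.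

(** * Values of a fixed policy, approximated over finite horizons *)

Section policy.
Variable pi : S -> dist R A.
Let g := step_dist P pi.

Lemma step_dist_avg (f : S * A -> R) x :
  \sum_y g x y * f y = \sum_s P x.1 x.2 s * \sum_a pi s a * f (s, a).
Proof.
under [RHS]eq_bigr do rewrite mulr_sumr.
rewrite pair_bigA; apply: eq_bigr => -[s a] _ /=.
by rewrite /step_fun mulrA.
Qed.

(** Dynamic programming form of the expected discounted reward of the first [n] steps under [pi]. *)
Fixpoint horizon_value n (x : S * A) : R :=
  if n is n'.+1 then r x.1 x.2 + gamma * \sum_y g x y * horizon_value n' y else 0.

Lemma horizon_valueS n x :
  horizon_value n.+1 x = r x.1 x.2 + gamma * \sum_y g x y * horizon_value n y.
Proof. by []. Qed.

Definition partial_return n (x : nat -> S * A) :=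
  series (fun t => gamma ^+ t * r (x t).1 (x t).2) n.

Lemma cexp_partial_return k n x :
  cexp g k n x (fun y => partial_return k (fun t => y (n + t)%N)) = horizon_value k (x n).
Proof.
elim: k n x => [|k IH] n x; first by rewrite /= /partial_return seriesEnat /= big_geq.
rewrite cexpS horizon_valueS.
transitivity
  (\sum_e g (x n) e * (r (x n).1 (x n).2 + gamma * horizon_value k e)); last first.
  under eq_bigr do rewrite mulrDr.
  rewrite big_split /= (dist_avg_cst (g (x n))) mulr_sumr; congr (_ + _).
  by apply: eq_bigr => e _; rewrite mulrCA.
apply: eq_bigr => e _; congr (_ * _).
have -> : horizon_value k e = horizon_value k (upd x n.+1 e n.+1) by rewrite upd_eq.
rewrite -IH -cexpZ -{1}(cexp_cst g k n.+1 (upd x n.+1 e) (r (x n).1 (x n).2)) -cexpD.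
apply: eq_cexp_agree => y yx; rewrite /partial_return !seriesEnat /=.
rewrite big_nat_recl // expr0 mul1r addn0; congr (_ + _).
  by rewrite yx ?upd_lt.
rewrite mulr_sumr; apply: eq_bigr => t _.
by rewrite exprS -mulrA addSnnS.
Qed.

Lemma partial_return_ge0 n x : 0 <= partial_return n x.
Proof.
rewrite /partial_return seriesEnat; apply: sumr_ge0 => t _.
by rewrite mulr_ge0 ?exprn_ge0 //; case/andP: (r01 (x t).1 (x t).2).
Qed.

Lemma partial_return_nondecreasing x : nondecreasing_seq (partial_return^~ x).
Proof.
apply: nondecreasing_series => t _.
by rewrite mulr_ge0 ?exprn_ge0 //; case/andP: (r01 (x t).1 (x t).2).
Qed.

(** Each new reward is at most 1 and [1 + gamma * vmax = vmax], so the partial return plus its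
    largest possible remainder decreases with the horizon. *)
Lemma partial_return_tail n N x : (n <= N)%N ->
  partial_return N x + gamma ^+ N * vmax <= partial_return n x + gamma ^+ n * vmax.
Proof.
elim: N => [|N IH]; first by rewrite leqn0 => /eqP ->.
rewrite leq_eqVlt => /orP[/eqP -> //|nN]; apply: le_trans (IH nN).
rewrite /partial_return !seriesEnat /= big_nat_recr //= -addrA lerD2l.
rewrite -[X in _ <= _ * X]vmax_fix mulrDr exprSr -mulrA lerD2r ler_wpM2l ?exprn_ge0 //.
by case/andP: (r01 (x N).1 (x N).2).
Qed.

Lemma partial_return_cvg x :
  partial_return^~ x @ \oo --> discounted_return r gamma x.
Proof.
apply: (@nondecreasing_is_cvgn _ (partial_return^~ x)).
  exact: partial_return_nondecreasing.
exists vmax => _ [n _ <-].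
have := partial_return_tail x (leq0n n).
rewrite {2}/partial_return seriesEnat /= big_geq // add0r expr0 mul1r.
by apply: le_trans; rewrite lerDl mulr_ge0 ?exprn_ge0 // ltW // vmax_gt0.
Qed.

Lemma discounted_return_bounds n x :
  partial_return n x <= discounted_return r gamma x <=
  partial_return n x + gamma ^+ n * vmax.
Proof.
have cvg := @partial_return_cvg x; apply/andP; split.
  rewrite -(cvg_lim (@Rhausdorff R) cvg).
  apply: (nondecreasing_cvgn_le (@partial_return_nondecreasing x)).
  by apply/cvg_ex; eexists; exact: cvg.
rewrite -(cvg_lim (@Rhausdorff R) cvg).
apply: limr_le; first by apply/cvg_ex; eexists; exact: cvg.
near=> N; apply: le_trans (partial_return_tail x (_ : n <= N)%N).
  by rewrite lerDl mulr_ge0 ?exprn_ge0 // ltW // vmax_gt0.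
by near: N; exists n.
Unshelve. all: by end_near. Qed.

(** The return depends on infinitely many times, so it is squeezed pathwise between two functions of
    the first [n] rewards, whose expectations are finite sums. *)
Lemma Qvalue_bounds n s a :
  horizon_value n (s, a) <= Qvalue P r gamma pi s a <=
  horizon_value n (s, a) + gamma ^+ n * vmax.
Proof.
have XP := trajectoryP P pi (dirac_dist R (s, a)).
set X := trajectory P pi _ in XP *.
have hor k : finite_horizon k (partial_return k).
  move=> x y xy; rewrite /partial_return !seriesEnat /=.
  by apply: eq_big_nat => t /andP[_ tk]; rewrite xy // ltnW.
have avg k (h : (nat -> S * A) -> R) :
    \sum_e dirac_dist R (s, a) e * cexp g k 0 (fun=> e) h =
    cexp g k 0 (fun=> (s, a)) h.
  rewrite (bigD1 (s, a)) //= eqxx mul1r big1 ?addr0 // => e /negbTE ->.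
  by rewrite mul0r.
have mpart k := measurable_finite_horizon XP (hor k).
have mret : measurable_fun setT
    (fun u => discounted_return r gamma (fun t => X t u)).
  apply: (@measurable_fun_cvg _ _ _ _ (fun k u => partial_return k (X^~ u))).
    exact: mpart.
  by move=> u _; exact: (@partial_return_cvg (X^~ u)).
pose EG := 'E_(uniform_prob (@ltr01 R))[fun u => discounted_return r gamma
    (fun t => X t u)]%E.
have tail0 : 0 <= gamma ^+ n * vmax.
  by rewrite mulr_ge0 ?exprn_ge0 // ltW // vmax_gt0.
have EGge : ((horizon_value n (s, a))%:E <= EG)%E.
  have := expectation_finite_horizon XP (partial_return_ge0 n) (hor n).
  rewrite avg (@cexp_partial_return n 0 (fun=> (s, a))) => <-.
  apply: expectation_le => //.
  - by move=> u; exact: partial_return_ge0.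
  - move=> u; have /andP[+ _] := discounted_return_bounds n (X^~ u).
    exact: le_trans (partial_return_ge0 _ _).
  - by apply: aeW => u; have /andP[] := discounted_return_bounds n (X^~ u).
have EGle : (EG <= (horizon_value n (s, a) + gamma ^+ n * vmax)%:E)%E.
  have hor' : finite_horizon n (fun x => partial_return n x + gamma ^+ n * vmax).
    by move=> x y xy; rewrite (hor n x y).
  have ge0' x : 0 <= partial_return n x + gamma ^+ n * vmax.
    by rewrite addr_ge0 // partial_return_ge0.
  have := expectation_finite_horizon XP ge0' hor'.
  rewrite avg cexpD cexp_cst (@cexp_partial_return n 0 (fun=> (s, a))) => <-.
  apply: expectation_le => //.
  - exact: (measurable_finite_horizon XP hor').
  - move=> u; have /andP[+ _] := discounted_return_bounds n (X^~ u).
    exact: le_trans (partial_return_ge0 _ _).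
  - by apply: aeW => u; have /andP[] := discounted_return_bounds n (X^~ u).
(* [fine] would send an infinite expectation to 0; the two bounds exclude this. *)
have EGfin : EG \is a fin_num.
  rewrite fin_numE; apply/andP; split; apply/eqP => E0.
    by move: EGge; rewrite E0.
  by move: EGle; rewrite E0.
by rewrite -!lee_fin /Qvalue -/X fineK ?EGge.
Qed.

Lemma horizon_value_le n s a : horizon_value n (s, a) <= value_fixpoint s a.
Proof.
elim: n s a => [|n IH] s a; first exact: value_fixpoint_ge0.
rewrite value_fixpointE horizon_valueS lerD2l ler_wpM2l // step_dist_avg le_dist_avg // => s'.
by apply: dist_avg_le => a'; apply: le_trans (fmax_ge _ a'); exact: IH.
Qed.

(** Under a greedy policy both sides obey the same recursion, so their gap, at most [vmax] at
    horizon 0, shrinks by [gamma] per step. *)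
Lemma horizon_value_greedy n s a :
  (forall s, \sum_a pi s a * value_fixpoint s a = fmax (value_fixpoint s)) ->
  value_fixpoint s a <= horizon_value n (s, a) + gamma ^+ n * vmax.
Proof.
move=> greedy; elim: n s a => [|n IH] s a.
  by rewrite add0r expr0 mul1r value_fixpoint_le_vmax.
rewrite value_fixpointE horizon_valueS -addrA lerD2l exprS -mulrA -mulrDr ler_wpM2l //.
rewrite step_dist_avg -[X in _ <= _ + X](dist_avg_cst (P s a)) -big_split /=.
apply: ler_sum => s' _; rewrite -mulrDr ler_wpM2l ?dist_ge0 // -greedy.
rewrite -[X in _ <= _ + X](dist_avg_cst (pi s')) -big_split /=.
by apply: ler_sum => a' _; rewrite -mulrDr ler_wpM2l ?dist_ge0.
Qed.

End policy.

Lemma le_of_geometric x y : (forall n, x <= y + gamma ^+ n * vmax) -> x <= y.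
Proof.
move=> H; have c : (fun n => y + vmax * gamma ^+ n) @ \oo --> y.
  rewrite -[X in _ --> X]addr0; apply: cvgD; first exact: cvg_cst.
  rewrite -[X in _ --> X](mulr0 vmax); apply: cvgMr; apply: cvg_expr.
  by rewrite ger0_norm //; case/andP: gamma01.
rewrite -(cvg_lim (@Rhausdorff R) c); apply: limr_ge.
  by apply/cvg_ex; exists y.
by apply: nearW => n; rewrite mulrC.
Qed.

(** No policy exceeds the fixed point at any horizon, and always playing a maximizer of it attains
    it in the limit. *)
Lemma QstarE s a : Qstar P r gamma s a = value_fixpoint s a.
Proof.
have Qle pi : Qvalue P r gamma pi s a <= value_fixpoint s a.
  apply: le_of_geometric => n.
  have /andP[_ /le_trans] := Qvalue_bounds pi n s a; apply.
  by rewrite lerD2r horizon_value_le.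
have /choice[act actP] : forall s, exists b, fmax (value_fixpoint s) = value_fixpoint s b.
  by move=> s'; have [] := fmaxP (value_fixpoint s') a0.
pose pi s' := dirac_dist R (act s').
have greedy s' : \sum_b pi s' b * value_fixpoint s' b = fmax (value_fixpoint s').
  rewrite actP (bigD1 (act s')) //= eqxx mul1r big1 ?addr0 // => b /negbTE ->.
  by rewrite mul0r.
apply/eqP; rewrite eq_le; apply/andP; split.
  by apply: ge_sup => [|_ [pi' _ <-] //]; exists (Qvalue P r gamma pi s a), pi.
apply: (@le_trans _ _ (Qvalue P r gamma pi s a)).
  apply: le_of_geometric => n; apply: le_trans (horizon_value_greedy n s a greedy) _.
  by rewrite lerD2r; have /andP[] := Qvalue_bounds pi n s a.
apply: ub_le_sup; last by exists pi.
by exists (value_fixpoint s a) => _ [pi' _ <-].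
Qed.

Lemma Qstar_bellman s a : Qstar P r gamma s a = T (Qstar P r gamma) s a.
Proof.
have -> : Qstar P r gamma = value_fixpoint.
  by apply/funext => s'; apply/funext => a'; exact: QstarE.
exact: value_fixpointE.
Qed.

Lemma Qstar_bounds s a : 0 <= Qstar P r gamma s a <= vmax.
Proof. by rewrite QstarE value_fixpoint_ge0 value_fixpoint_le_vmax. Qed.

End optimality.

(** * Second moment of the noise *)

(** With equal total masses the other points balance the deviation at [s], which thus counts twice
    in the sum; the factor 1/2 compensates. *)
Lemma le_tv_dist (R : realType) (S : finType) (p q : S -> R) s :
  \sum_s' p s' = \sum_s' q s' -> `|p s - q s| <= tv_dist p q.
Proof.
move=> pq; rewrite /tv_dist.
have : \sum_s' (p s' - q s') = 0 by rewrite sumrB pq subrr.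
rewrite (bigD1 s) //= [X in _ * X](bigD1 s) //= => /eqP; rewrite addr_eq0 => /eqP E.
have : `|p s - q s| <= \sum_(s' | s' != s) `|p s' - q s'|.
  by rewrite E normrN; exact: ler_norm_sum.
lra.
Qed.

(** The sums obey [S_(b+1) = kappa S_b + 1], whose fixed point is the bound. The exponent is one
    less than the lag from time [i] to time [b]. *)
Lemma sum_geometric_rev_le (R : realFieldType) (kappa : R) b : 0 <= kappa < 1 ->
  \sum_(i < b) kappa ^+ (b.-1 - i) <= (1 - kappa)^-1.
Proof.
move=> /andP[k0 k1]; elim: b => [|b IH].
  by rewrite big_ord0 invr_ge0 subr_ge0 ltW.
rewrite big_ord_recr /= subnn expr0.
have -> : \sum_(i < b) kappa ^+ (b - i) = kappa * \sum_(i < b) kappa ^+ (b.-1 - i).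
  rewrite mulr_sumr; apply: eq_bigr => i _; rewrite -exprS; congr (_ ^+ _).
  by have := ltn_ord i; lia.
apply: le_trans (_ : kappa * (1 - kappa)^-1 + 1 <= _).
  by rewrite lerD2r ler_wpM2l.
have : 1 - kappa != 0 by rewrite subr_eq0 eq_sym lt_eqF.
by move=> ?; rewrite le_eqVlt; apply/orP; left; apply/eqP; field.
Qed.

Section noise.
Context {R : realType} {S A : finType}.
Variables (P : S -> A -> dist R S) (r : S -> A -> R) (gamma : R) (a0 : A).
Hypothesis r01 : forall s a, 0 <= r s a <= 1.
Hypothesis gamma01 : 0 <= gamma < 1.
Variables (pib : S -> dist R A) (nu : dist R S) (m kappa : R).
Hypothesis m_gt0 : 0 < m.
Hypothesis kappa01 : 0 < kappa < 1.
Hypothesis mixing : mixes_at_rate (policy_kernel P pib) nu m kappa.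

Let g := step_dist P pib.
Let M := policy_kernel P pib.
Let vmax := (1 - gamma)^-1.
Let T := bellman P r gamma.
Implicit Types (Q : S -> A -> R) (x y z : nat -> S * A).

Let gamma_ge0 : 0 <= gamma. Proof. by case/andP: gamma01. Qed.
Let vmax_ge0 : 0 <= vmax. Proof. exact/ltW/vmax_gt0. Qed.

Lemma nstep_policy_sum1 n s : \sum_s' nstep M n s s' = 1.
Proof.
elim: n => [|n IH] /=.
  rewrite (bigD1 s) //= eqxx big1 ?addr0 // => i /negbTE.
  by rewrite eq_sym => ->.
rewrite exchange_big -[RHS]IH; apply: eq_bigr => s1 _ /=.
rewrite -mulr_sumr /M /policy_kernel exchange_big /=.
under eq_bigr do rewrite -mulr_sumr dist_sum1 mulr1.
by rewrite dist_sum1 mulr1.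
Qed.

(** Mixing is assumed for states, but the trajectory is a chain of pairs. When the starting action
    is drawn from [pib], the law of the pair factors through that of the state. *)
Lemma nstep_pair d s (y : S * A) :
  \sum_a pib s a * nstep (fun e e' => g e e') d (s, a) y = nstep M d s y.1 * pib y.1 y.2.
Proof.
elim: d y => [|d IH] [s1 a1] /=.
  have [->|ss1] := eqVneq s s1.
    rewrite (bigD1 a1) //= eqxx mulr1 mul1r big1 ?addr0 // => a /negbTE aa1.
    by rewrite xpair_eqE eqxx aa1 mulr0.
  rewrite mul0r big1 // => a _.
  by rewrite xpair_eqE (negbTE ss1) mulr0.
under eq_bigr do rewrite mulr_sumr.
rewrite exchange_big /= mulr_suml.
transitivity (\sum_z nstep M d s z.1 * pib z.1 z.2 * g z (s1, a1)).
  apply: eq_bigr => z _; rewrite -IH mulr_suml.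
  by apply: eq_bigr => a _; rewrite mulrA.
transitivity (\sum_s2 \sum_a2 nstep M d s s2 * pib s2 a2 * g (s2, a2) (s1, a1)).
  by rewrite pair_bigA; apply: eq_bigr => -[].
apply: eq_bigr => s2 _; rewrite -mulrA mulr_suml mulr_sumr.
by apply: eq_bigr => a2 _; rewrite /g /= /step_fun /=; ring.
Qed.

Definition bounded_Q Q := forall s a, 0 <= Q s a <= vmax.

(** The bounds are relative to [Q s a] because the target, [Q s a] plus the error, must stay in
    [[0, vmax]] to keep the iterates there. *)
Lemma td_error_bounds Q s a s1 : bounded_Q Q ->
  - Q s a <= td_error r gamma Q s a s1 <= vmax - Q s a.
Proof.
move=> bQ; have /andP[r0 r1] := r01 s a.
have f0 : 0 <= gamma * fmax (Q s1).
  by rewrite mulr_ge0 // (le_trans _ (fmax_ge _ a0)) //; case/andP: (bQ s1 a0).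
have f1 : gamma * fmax (Q s1) <= gamma * vmax.
  by rewrite ler_wpM2l // (fmax_le a0) // => a1; case/andP: (bQ s1 a1).
by have := vmax_fix gamma01; rewrite /td_error -/vmax; lra.
Qed.

Lemma bellman_td_error Q s a :
  \sum_s1 P s a s1 * td_error r gamma Q s a s1 = T Q s a - Q s a.
Proof.
rewrite -[in RHS](dist_avg_cst (P s a) (Q s a)) /T /bellman mulr_sumr.
rewrite -{1}[r s a](dist_avg_cst (P s a)) -big_split -sumrB /=.
by apply: eq_bigr => s1 _; rewrite /td_error; ring.
Qed.

Lemma bellman_residual_norm Q s a : bounded_Q Q -> `|T Q s a - Q s a| <= vmax.
Proof.
move=> bQ; rewrite -bellman_td_error; apply: dist_avg_norm => s1.
have := td_error_bounds s a s1 bQ; have := bQ s a; rewrite ler_norml; lra.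
Qed.

Definition td_term Q s a (e : S * A) (s1 : S) :=
  if e == (s, a) then td_error r gamma Q e.1 e.2 s1 else 0.

(** Mean of [td_term] when the state is drawn from [nu], the action from [pib] and the next state
    from [P]. *)
Definition drift Q s a := nu s * pib s a * (T Q s a - Q s a).

Definition noise Q s a e s1 := td_term Q s a e s1 - drift Q s a.

Lemma drift_norm Q s a : bounded_Q Q -> `|drift Q s a| <= vmax.
Proof.
move=> bQ; rewrite normrM -[leRHS]mul1r ler_pM ?normr_ge0 //; last first.
  exact: bellman_residual_norm.
rewrite ger0_norm ?mulr_ge0 ?dist_ge0 // -[leRHS]mul1r.
by rewrite ler_pM ?dist_ge0 ?dist_le1.
Qed.

Lemma noise_norm Q s a e s1 : bounded_Q Q -> `|noise Q s a e s1| <= 2 * vmax.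
Proof.
move=> bQ; have td : `|td_term Q s a e s1| <= vmax.
  rewrite /td_term; case: ifP => _; last by rewrite normr0.
  have := td_error_bounds e.1 e.2 s1 bQ; have := bQ e.1 e.2; rewrite ler_norml; lra.
apply: le_trans (ler_normB _ _) _.
by have := drift_norm s a bQ; lra.
Qed.

Lemma noise_step_avg Q s a e :
  \sum_e' g e e' * noise Q s a e e'.1 =
  (if e == (s, a) then T Q s a - Q s a else 0) - drift Q s a.
Proof.
rewrite step_dist_avg /=.
under eq_bigr do rewrite -mulr_suml dist_sum1 mul1r.
rewrite -[X in _ = _ - X](dist_avg_cst (P e.1 e.2)) /noise.
under eq_bigr do rewrite mulrBr.
rewrite sumrB; congr (_ - _); rewrite /td_term.
case: eqP => [->|_]; first exact: bellman_td_error.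
by rewrite big1 // => s1 _; rewrite mulr0.
Qed.

(* Only the current state s' is known, not the action taken there. *)
Lemma future_noise_mean Q s a d k n x s' :
  \sum_a' pib s' a' * cexp g (d + k.+1) n (upd x n (s', a'))
    (fun y => noise Q s a (y (n + d)%N) (y (n + d).+1).1) =
  (nstep M d s' s - nu s) * pib s a * (T Q s a - Q s a).
Proof.
set D := T Q s a - Q s a.
pose f e := (if e == (s, a) then D else 0) - drift Q s a.
transitivity (\sum_a' pib s' a' *
    \sum_e nstep (fun e e' => g e e') d (s', a') e * f e).
  apply: eq_bigr => a' _; congr (_ * _).
  rewrite -[X in nstep _ _ X](upd_eq x n (s', a')) -(cexp_nstep g d 0) addn0.
  (* Given the pair at time [n + d], averaging over the next transition turns the noise into [f] of
     that pair. *)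
  rewrite cexp_tower; apply: eq_cexp_agree => y _.
  rewrite /f -noise_step_avg cexpS; apply: eq_bigr => e _; congr (_ * _).
  rewrite -[RHS](cexp_cst g k (n + d).+1 (upd y (n + d).+1 e)).
  apply: eq_cexp_agree => z zy; rewrite !zy ?leqnSn // upd_eq upd_lt //.
under eq_bigr do rewrite mulr_sumr.
rewrite exchange_big /=.
transitivity (\sum_e nstep M d s' e.1 * pib e.1 e.2 * f e).
  apply: eq_bigr => e _; rewrite -nstep_pair mulr_suml.
  by apply: eq_bigr => a' _; rewrite mulrA.
rewrite /f; under eq_bigr do rewrite mulrBr.
rewrite sumrB -mulr_suml.
(* Total mass 1 keeps [drift] whole, so that [nu s] is subtracted exactly from [nstep M d s' s]. *)
have -> : \sum_e nstep M d s' e.1 * pib e.1 e.2 = 1.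
  rewrite -[RHS](nstep_policy_sum1 d s').
  transitivity (\sum_s1 \sum_a1 nstep M d s' s1 * pib s1 a1).
    by rewrite pair_bigA; apply: eq_bigr => -[].
  by apply: eq_bigr => s1 _; rewrite -mulr_sumr dist_sum1 mulr1.
rewrite mul1r (bigD1 (s, a)) //= eqxx big1 ?addr0 => [|e /negbTE ->]; last first.
  by rewrite mulr0.
by rewrite /drift -/D; ring.
Qed.

Definition noise_at Q s a n y := noise Q s a (y n) (y n.+1).1.

(** The earlier term reveals the state at time [n + i + 1] but not the action there. Given that
    state the later term has mean at most [m * kappa ^+ d * vmax] in absolute value, and the earlier
    term is at most [2 * vmax]. *)
Lemma noise_correlation Q s a n i d k x : bounded_Q Q ->
  `|cexp g (i + (d + k.+1).+1) n x
     (fun y => noise_at Q s a (n + i) y * noise_at Q s a (n + i + d.+1) y)| <=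
  2 * vmax ^+ 2 * m * kappa ^+ d.
Proof.
move=> bQ; rewrite cexp_tower; apply: cexp_norm => z _.
move: (n + i)%N => {i}{}n; rewrite cexpS.
pose D := T Q s a - Q s a.
have -> : \sum_e g (z n) e * cexp g (d + k.+1) n.+1 (upd z n.+1 e)
      (fun y => noise_at Q s a n y * noise_at Q s a (n + d.+1) y) =
    \sum_s' P (z n).1 (z n).2 s' *
      (noise Q s a (z n) s' * ((nstep M d s' s - nu s) * pib s a * D)).
  transitivity (\sum_e g (z n) e * (noise Q s a (z n) e.1 *
      cexp g (d + k.+1) n.+1 (upd z n.+1 e)
        (fun y => noise Q s a (y (n.+1 + d)%N) (y (n.+1 + d).+1).1))).
    (* Once the pair at time [n.+1] is drawn, the earlier noise term is known and leaves the
       expectation. *)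
    apply: eq_bigr => e _; congr (_ * _); apply: cexp_known => y yz.
    by rewrite /noise_at addnS addSn (yz n (leqnSn n)) (yz n.+1) // upd_eq upd_lt.
  rewrite step_dist_avg; apply: eq_bigr => s' _; congr (_ * _).
  rewrite -(future_noise_mean Q s a d k n.+1 z) mulr_sumr.
  by apply: eq_bigr => a' _; rewrite mulrCA.
apply: dist_avg_norm => s'; rewrite !normrM.
have -> : 2 * vmax ^+ 2 * m * kappa ^+ d = 2 * vmax * (m * kappa ^+ d * 1 * vmax).
  by ring.
rewrite ler_pM ?normr_ge0 ?mulr_ge0 ?noise_norm //.
rewrite ler_pM ?mulr_ge0 ?normr_ge0 ?bellman_residual_norm // ler_pM ?normr_ge0 //.
  rewrite distrC; apply: le_trans (mixing s' d).
  by apply: le_tv_dist; rewrite dist_sum1 nstep_policy_sum1.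
by rewrite ger0_norm ?dist_ge0 ?dist_le1.
Qed.

(** Induction on [b]: a new term adds its square, at most [4 * vmax ^+ 2], and twice its
    correlations with the earlier ones, whose sum is at most [2 * vmax ^+ 2 * m / (1 - kappa)] by
    the geometric decay. *)
Lemma noise_second_moment Q s a n b L x : bounded_Q Q -> (b <= L)%N ->
  cexp g L n x (fun y => (\sum_(t < b) noise_at Q s a (n + t) y) ^+ 2) <=
  b%:R * (4 * vmax ^+ 2 * (1 + m / (1 - kappa))).
Proof.
move=> bQ; elim: b => [_|b IH bL].
  by rewrite mul0r; apply: cexp_le => y _; rewrite big_ord0 expr0n.
pose N t := noise_at Q s a (n + t).
have -> : cexp g L n x (fun y => (\sum_(t < b.+1) N t y) ^+ 2) =
    cexp g L n x (fun y => (\sum_(t < b) N t y) ^+ 2) +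
    (2 * \sum_(t < b) cexp g L n x (fun y => N t y * N b y) +
     cexp g L n x (fun y => N b y ^+ 2)).
  rewrite -cexp_sum -cexpZ -!cexpD; apply: eq_cexp_agree => y _.
  by rewrite big_ord_recr /= -mulr_suml; ring.
rewrite -[b.+1%:R]natr1 [leRHS]mulrDl lerD ?IH ?(ltnW bL) // mul1r.
have sq : cexp g L n x (fun y => N b y ^+ 2) <= 4 * vmax ^+ 2.
  apply: cexp_le => y _; rewrite (_ : 4 * _ = (2 * vmax) ^+ 2); last by ring.
  by rewrite -real_normK ?num_real // lerXn2r ?nnegrE ?mulr_ge0 // noise_norm.
have cross : \sum_(t < b) cexp g L n x (fun y => N t y * N b y) <=
    2 * vmax ^+ 2 * m * (1 - kappa)^-1.
  apply: (@le_trans _ _ (\sum_(t < b) 2 * vmax ^+ 2 * m * kappa ^+ (b.-1 - t))).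
    apply: ler_sum => t _; apply: le_trans (ler_norm _) _.
    have tb := ltn_ord t.
    (* [t] steps lead to the earlier term, [b.-1 - t] is the lag less one, and [L - b.+1] steps
       remain once the later term is revealed. *)
    have EL : L = (t + ((b.-1 - t) + (L - b.+1).+1).+1)%N by lia.
    have Eb : (n + b)%N = (n + t + (b.-1 - t).+1)%N by lia.
    by rewrite EL /N Eb; exact: noise_correlation.
  rewrite -mulr_sumr ler_wpM2l ?sum_geometric_rev_le //.
    by rewrite !mulr_ge0 ?exprn_ge0 // ltW.
  by case/andP: kappa01 => /ltW -> ->.
by lra.
Qed.

End noise.

(** * Recursion for the error *)

Section iteration.
Context {R : realType} {S A : finType}.
Variables (P : S -> A -> dist R S) (r : S -> A -> R) (gamma : R) (s0 : S) (a0 : A).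
Hypothesis r01 : forall s a, 0 <= r s a <= 1.
Hypothesis gamma01 : 0 <= gamma < 1.
Variables (pib : S -> dist R A) (nu : dist R S) (m kappa : R).
Hypothesis m_gt0 : 0 < m.
Hypothesis kappa01 : 0 < kappa < 1.
Hypothesis mixing : mixes_at_rate (policy_kernel P pib) nu m kappa.
Variables (B : nat -> nat) (alpha : R).
Hypothesis B_gt0 : forall k, (0 < B k)%N.
Hypothesis alpha01 : 0 < alpha <= 1.
Implicit Types (x y : nat -> S * A).

Let g := step_dist P pib.
Let vmax := (1 - gamma)^-1.
Let T := bellman P r gamma.
Let Qs := Qstar P r gamma.
Let rho := 1 - (1 - gamma) * alpha * min_occupation nu pib.
Let Q x k :=
  batch_Q r gamma (fun=> alpha) B (fun k _ => (B k)%:R^-1) x k.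

Let gamma_ge0 : 0 <= gamma. Proof. by case/andP: gamma01. Qed.
Let vmax_ge0 : 0 <= vmax. Proof. exact/ltW/vmax_gt0. Qed.

(** * Timing and boundedness of the iterates *)

Lemma batch_startS k : batch_start B k.+1 = (batch_start B k + B k)%N.
Proof. by rewrite /batch_start big_ord_recr. Qed.

Lemma batch_start_le j k : (j <= k)%N -> (batch_start B j <= batch_start B k)%N.
Proof.
elim: k => [|k IH]; first by rewrite leqn0 => /eqP ->.
rewrite leq_eqVlt => /orP[/eqP -> //|/IH jk].
by rewrite batch_startS (leq_trans jk) // leq_addr.
Qed.

Lemma batch_avg_bounds b (f : nat -> R) l u : (0 < b)%N ->
  (forall t, l <= f t <= u) -> l <= \sum_(t < b) b%:R^-1 * f t <= u.
Proof.
move=> b0 fb; have nz : b%:R != 0 :> R by rewrite pnatr_eq0 -lt0n.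
have avg c : \sum_(t < b) b%:R^-1 * c = c :> R.
  by rewrite sumr_const card_ord -[LHS]mulr_natl mulrA divff ?mul1r.
rewrite -{1}(avg l) -{1}(avg u).
by apply/andP; split; apply: ler_sum => t _; rewrite ler_wpM2l ?invr_ge0 //;
  case/andP: (fb t).
Qed.

Lemma batch_QS x k s a : Q x k.+1 s a = Q x k s a + alpha * \sum_(t < B k)
  (B k)%:R^-1 * td_term r gamma (Q x k) s a
    (x (batch_start B k + t)%N) (x (batch_start B k + t).+1).1.
Proof. by []. Qed.

(** Adding the full averaged error to the iterate gives a point of [[0, vmax]]; since [alpha <= 1],
    the update stays on the segment leading to it. *)
Lemma batch_Q_bounded x k : bounded_Q gamma (Q x k).
Proof.
elim: k => [|k IH] s a; first by rewrite lexx.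
rewrite batch_QS; set avg := \sum_(_ < _) _.
have : - Q x k s a <= avg <= vmax - Q x k s a.
  apply: (@batch_avg_bounds _ (fun t => td_term r gamma (Q x k) s a
    (x (batch_start B k + t)%N) (x (batch_start B k + t).+1).1)) => // t.
  have := IH s a; rewrite /td_term; case: eqP => [->|_]; last by rewrite -/vmax; lra.
  by move=> _; exact: td_error_bounds.
have := IH s a; rewrite -/vmax => /andP[q0 q1] /andP[a1 a2].
have /andP[al0 al1] := alpha01; apply/andP; split.
  have := ler_wpM2l (ltW al0) a1; have := ler_wpM2r q0 al1; lra.
have := ler_wpM2l (ltW al0) a2.
have : alpha * (vmax - Q x k s a) <= 1 * (vmax - Q x k s a).
  by rewrite ler_wpM2r // subr_ge0.
by lra.
Qed.

(** The last entry read by a batch is at the starting time of the next one. Conditioning on the path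
    up to that time therefore freezes the iterate. *)
Lemma batch_Q_agree k x y : agree (batch_start B k) x y -> Q x k = Q y k.
Proof.
elim: k => [//|k IH] xy.
have xyk : agree (batch_start B k) x y.
  by apply: agreeW xy; rewrite batch_startS leq_addr.
apply/funext => s; apply/funext => a; rewrite !batch_QS (IH xyk).
congr (_ + _ * _); apply: eq_bigr => t _.
by rewrite !xy // batch_startS ?ltn_add2l // leq_add2l ltnW.
Qed.

Definition batch_noise x k s a : R := (B k)%:R^-1 * \sum_(t < B k)
  noise_at P r gamma pib nu (Q x k) s a (batch_start B k + t) x.

Lemma batch_Q_drift_noise x k s a : Q x k.+1 s a =
  Q x k s a + alpha * (drift P r gamma pib nu (Q x k) s a + batch_noise x k s a).
Proof.
rewrite batch_QS /batch_noise /noise_at /noise sumrB sumr_const card_ord -mulr_sumr.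
have nz : (B k)%:R != 0 :> R by rewrite pnatr_eq0 -lt0n.
congr (_ + alpha * _); rewrite mulrBr -[X in _ - _ * X]mulr_natl mulrA mulVf //.
by ring.
Qed.

(** * Contraction of the sup-norm error along a path *)

Lemma le_supnorm (f : S -> A -> R) s a : `|f s a| <= supnorm f.
Proof. exact: (fmax_ge (fun x : S * A => `|f x.1 x.2|) (s, a)). Qed.

Lemma supnorm_le (f : S -> A -> R) c :
  (forall s a, `|f s a| <= c) -> supnorm f <= c.
Proof. by move=> fc; apply: fmax_le (s0, a0) _ => -[]. Qed.

Lemma supnorm_ge0 (f : S -> A -> R) : 0 <= supnorm f.
Proof. by apply: le_trans (le_supnorm f s0 a0). Qed.

Let err x k := supnorm (fun s a => Qs s a - Q x k s a).

Lemma occupation_bounds s a : min_occupation nu pib <= nu s * pib s a <= 1.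
Proof.
apply/andP; split.
  by have [_ /(_ (s, a))] := fminP (fun x : S * A => nu x.1 * pib x.1 x.2) (s, a).
by rewrite -[leRHS]mul1r ler_pM ?dist_ge0 ?dist_le1.
Qed.

Lemma rho_ge0 : 0 <= rho.
Proof.
have /andP[om oM] := occupation_bounds s0 a0.
have /andP[al0 al1] := alpha01; have /andP[g0 g1] := gamma01.
have le1 : (1 - gamma) * alpha <= 1.
  by rewrite -[leRHS]mul1r ler_pM ?subr_ge0 ?(ltW g1) ?(ltW al0) // lerBlDr lerDl.
have ge0 : 0 <= (1 - gamma) * alpha by rewrite mulr_ge0 ?subr_ge0 ?ltW.
have : (1 - gamma) * alpha * min_occupation nu pib <= (1 - gamma) * alpha * 1.
  by rewrite ler_wpM2l // (le_trans om oM).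
by rewrite /rho; lra.
Qed.

(** At each pair, of occupation [o], the old error has weight [1 - alpha * o] and a
    [gamma]-contracted error has weight [alpha * o]. The total [1 - (1 - gamma) * alpha * o] is at
    most [rho] because [o] is at least the minimal occupation. *)
Lemma error_step x k : err x k.+1 <= rho * err x k + alpha * supnorm (batch_noise x k).
Proof.
have /andP[al0 al1] := alpha01.
apply: supnorm_le => s a; rewrite batch_Q_drift_noise /drift.
have /andP[om oM] := occupation_bounds s a.
set o := nu s * pib s a in om oM *; set w := batch_noise x k s a.
set e := err x k; have e0 : 0 <= e by exact: supnorm_ge0.
have ewk : `|w| <= supnorm (batch_noise x k) by exact: le_supnorm.
have o0 : 0 <= alpha * o by rewrite !mulr_ge0 ?dist_ge0 // ltW.
have ao1 : alpha * o <= 1 by rewrite -[leRHS]mul1r ler_pM ?mulr_ge0 ?dist_ge0 // ltW.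
have -> : Qs s a - (Q x k s a + alpha * (o * (T (Q x k) s a - Q x k s a) + w)) =
    (1 - alpha * o) * (Qs s a - Q x k s a) +
    alpha * o * (T Qs s a - T (Q x k) s a) - alpha * w.
  have <- : Qs s a = T Qs s a := Qstar_bellman P a0 r01 gamma01 s a.
  by ring.
have Te : `|T Qs s a - T (Q x k) s a| <= gamma * e.
  rewrite /T /bellman opprD addrACA subrr add0r -mulrBr normrM ger0_norm //.
  rewrite ler_wpM2l // -sumrB; under eq_bigr do rewrite -mulrBr.
  apply: dist_avg_norm => s'; apply: (fmax_lipschitz a0) => a'.
  exact: (le_supnorm (fun s a => Qs s a - Q x k s a)).
apply: le_trans (ler_normB _ _) _; apply: lerD; last first.
  by rewrite normrM (ger0_norm (ltW al0)) ler_wpM2l // ltW.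
apply: le_trans (ler_normD _ _) _; rewrite normrM [X in _ + X]normrM (ger0_norm o0).
rewrite ger0_norm ?subr_ge0 //.
apply: (@le_trans _ _ ((1 - alpha * o) * e + alpha * o * (gamma * e))).
  rewrite lerD ?ler_wpM2l ?subr_ge0 //.
  exact: (le_supnorm (fun s a => Qs s a - Q x k s a)).
rewrite (_ : _ + _ = (1 - (1 - gamma) * alpha * o) * e); last by ring.
rewrite ler_wpM2r // lerB // ler_wpM2l // mulr_ge0 ?(ltW al0) // subr_ge0 ltW //.
by case/andP: gamma01.
Qed.

Lemma error_unroll x k : err x k <= vmax * rho ^+ k +
  alpha * \sum_(j < k) rho ^+ (k - 1 - j) * supnorm (batch_noise x j).
Proof.
elim: k => [|k IH].
  (* The iteration starts at 0 and [Qs] lies in [[0, vmax]], whence the factor [vmax]. *)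
  rewrite big_ord0 mulr0 addr0 expr0 mulr1; apply: supnorm_le => s a.
  have /andP[q0 q1] := Qstar_bounds P a0 r01 gamma01 s a.
  by rewrite /= subr0 ger0_norm.
apply: le_trans (error_step x k) _.
rewrite big_ord_recr /= subSS subn0 subnn expr0 mul1r.
have -> : \sum_(j < k) rho ^+ (k - j) * supnorm (batch_noise x j) =
    rho * \sum_(j < k) rho ^+ (k - 1 - j) * supnorm (batch_noise x j).
  rewrite mulr_sumr; apply: eq_bigr => j _; rewrite mulrA -exprS; congr (_ ^+ _ * _).
  by have := ltn_ord j; lia.
have := ler_wpM2l rho_ge0 IH; rewrite exprS; lra.
Qed.

(** * Expected size of the noise and of the error *)

Let noise_variance := 4 * #|S|%:R * #|A|%:R / (1 - gamma) ^+ 2 * (1 + m / (1 - kappa)).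

Lemma noise_variance_ge0 : 0 <= noise_variance.
Proof.
have /andP[k0 k1] := kappa01; have /andP[g0 g1] := gamma01.
rewrite !mulr_ge0 ?invr_ge0 ?exprn_ge0 ?subr_ge0 ?(ltW g1) //.
by rewrite addr_ge0 // mulr_ge0 ?(ltW m_gt0) // invr_ge0 subr_ge0 ltW.
Qed.

(** Conditioning at the start of the batch freezes the iterate. Jensen passes to second moments, and
    the squared sup norm is at most the sum of squares over all pairs, whence [#|S| * #|A|]. A
    second moment linear in [B k], divided by its square, leaves [1 / B k]. *)
Lemma batch_noise_expectation k N x : (batch_start B k.+1 <= N)%N ->
  cexp g N 0 x (fun y => supnorm (batch_noise y k)) <=
  Num.sqrt noise_variance * (Num.sqrt (B k)%:R)^-1.
Proof.
move=> kN; set n := batch_start B k; set b := B k.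
have [L EN bL] : exists2 L, N = (n + L)%N & (b <= L)%N.
  by exists (N - n)%N; move: kN; rewrite batch_startS -/n -/b; lia.
rewrite EN cexp_tower add0n; apply: cexp_le => z _.
apply: le_trans (cexp_le_sqrt _ _ _ _ _) _.
rewrite -sqrtrV ?ler0n // -sqrtrM ?noise_variance_ge0 //.
apply: ler_wsqrtr.
have bQ := batch_Q_bounded z k.
apply: (@le_trans _ _ (cexp g L n z (fun y => \sum_(e : S * A)
    b%:R^-1 ^+ 2 * (\sum_(t < b)
      noise_at P r gamma pib nu (Q z k) e.1 e.2 (n + t) y) ^+ 2))).
  apply: le_cexp_agree => y yz.
  (* The sup norm is attained at some pair [e], so its square is one term of the sum. *)
  have [[e eE] _] := fmaxP (fun e : S * A => `|batch_noise y k e.1 e.2|) (s0, a0).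
  rewrite /supnorm eE /= real_normK ?num_real // /batch_noise exprMn (batch_Q_agree yz).
  rewrite (bigD1 e) //= lerDl; apply: sumr_ge0 => e' _.
  by rewrite mulr_ge0 ?sqr_ge0.
rewrite cexp_sum.
apply: (@le_trans _ _ (\sum_(e : S * A)
    b%:R^-1 ^+ 2 * (b%:R * (4 * vmax ^+ 2 * (1 + m / (1 - kappa)))))).
  apply: ler_sum => e _; rewrite cexpZ ler_wpM2l ?sqr_ge0 //.
  exact: noise_second_moment.
rewrite sumr_const card_prod -[leLHS]mulr_natl natrM /noise_variance /vmax.
have nz : b%:R != 0 :> R by rewrite pnatr_eq0 -lt0n B_gt0.
have nz' : 1 - gamma != 0 by rewrite subr_eq0 eq_sym lt_eqF //; case/andP: gamma01.
have nz'' : 1 - kappa != 0 by rewrite subr_eq0 eq_sym lt_eqF //; case/andP: kappa01.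
by rewrite le_eqVlt; apply/orP; left; apply/eqP; field; rewrite ?nz ?nz' ?nz''.
Qed.

Lemma error_expectation k x :
  cexp g (batch_start B k) 0 x (err^~ k) <=
  vmax * rho ^+ k + alpha * Num.sqrt noise_variance * Xi rho B k.
Proof.
apply: le_trans (le_cexp _ _ _ _ (error_unroll^~ k)) _.
rewrite cexpD cexp_cst lerD2l cexpZ -mulrA ler_wpM2l //; first by case/andP: alpha01 => /ltW.
rewrite cexp_sum /Xi mulr_sumr; apply: ler_sum => j _.
rewrite cexpZ mulrCA ler_wpM2l ?exprn_ge0 ?rho_ge0 //.
(* As [j < k], batch [j] ends within the horizon [batch_start B k]. *)
by rewrite batch_noise_expectation // batch_start_le.
Qed.

Lemma finite_horizon_error k : finite_horizon (batch_start B k) (err^~ k).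
Proof. by move=> x y xy; rewrite /err (batch_Q_agree xy). Qed.

End iteration.

Theorem corollary3p20 (R : realType) (S A : finType)
    (P : S -> A -> dist R S) (r : S -> A -> R)
    (r01 : forall s a, 0 <= r s a <= 1)
    (gamma : R) (gamma01 : 0 <= gamma < 1)
    (pib : S -> dist R A) (K : nat) (s0 : S)
    (B : nat -> nat) (B_gt0 : forall k, (0 < B k)%N)
    (alpha : R) (alpha01 : 0 < alpha <= 1)
    (d : measure_display) (Omega : measurableType d) (Pr : probability Omega R)
    (X : nat -> Omega -> S * A)
    (X_run : is_trajectory P pib (start_dist pib s0) Pr X)
    (pib_gt0 : 0 < min_prob pib)
    (ergodic_pib : ergodic_chain (policy_kernel P pib))
    (nu : dist R S) (nu_stationary : stationary (policy_kernel P pib) nu)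
    (m kappa : R) (m_gt0 : 0 < m) (kappa01 : 0 < kappa < 1)
    (mixing : mixes_at_rate (policy_kernel P pib) nu m kappa) :
  let sigma : R := min_occupation nu pib in
  let rho : R := 1 - (1 - gamma) * alpha * sigma in
  let QK (w : Omega) : S -> A -> R :=
    batch_Q r gamma (fun _ => alpha) B (fun k _ => (B k)%:R^-1)
      (fun t => X t w) K in
  let error (w : Omega) : R :=
    supnorm (fun s a => Qstar P r gamma s a - QK w s a) in
  let bound : R :=
    (1 - gamma)^-1 * rho ^+ K +
    alpha * Num.sqrt (4 * #|S|%:R * #|A|%:R / (1 - gamma) ^+ 2 *
                      (1 + m / (1 - kappa))) * Xi rho B K in
  ('E_Pr[error] <= bound%:E)%E.
Proof.
cbv zeta.
(* An action exists because [pib s0] has total mass 1. *)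
have [a0 _|A0] := pickP (xpredT : pred A); last first.
  by have := dist_sum1 (pib s0); rewrite big_pred0 // => /esym/eqP; rewrite oner_eq0.
pose err x := supnorm (fun s a => Qstar P r gamma s a -
  batch_Q r gamma (fun=> alpha) B (fun k _ => (B k)%:R^-1) x K s a).
have err0 x : 0 <= err x by exact: supnorm_ge0.
have horizon : finite_horizon (batch_start B K) err by exact: finite_horizon_error.
have := expectation_finite_horizon X_run err0 horizon; rewrite /err => ->.
rewrite lee_fin.
(* The bound holds from every initial pair, hence on average over the starting law. *)
apply: dist_avg_le => e.
exact: (error_expectation s0 a0 r01 gamma01 m_gt0 kappa01 mixing B_gt0 alpha01 K).
Qed.
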